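(* Let $\{X_t\}$ be an irreducible Markov chain on a finite state space $\Sigma$ and let $i\in\Sigma$, $\epsilon,\alpha\in(0,1)$. With probability greater than $1-\alpha$, the estimates $\hat\pi_i^{(k)}$ produced by $\mathrm{IteratedRefinement}(i,\epsilon/2,\alpha)$ satisfy $\pi_i\in(1\pm\epsilon)\hat\pi_i^{(k)}$ for all $$k\ge\log_2\left(2H_i\log_2\left(\frac{8Z_{\max}(i)}{\epsilon}\right)\right)=O\left(\ln\left(\frac{t_{\mathrm{mix}}}{\pi_i}\ln\left(\frac{t_{\mathrm{mix}}}{\epsilon}\right)\right)\right).$$ The number of random walk steps simulated by the algorithm until $\pi_i\in(1\pm\epsilon)\hat\pi_i^{(k)}$ is bounded by $$\tilde O\left(\frac{H_i\ln(1/\alpha)}{\epsilon^2}\ln\left(\frac{Z_{\max}(i)}{\epsilon}\right)\right)=\tilde O\left(\frac{t_{\mathrm{mix}}\ln(1/\alpha)}{\pi_i\epsilon^2}\right).$$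
   Context: Chain: $\{X_t\}_{t\ge0}$ is a discrete-time Markov chain with transition matrix $P$ and unique stationary distribution $\pi$; $\mathbb P_i(\cdot)=\mathbb P(\cdot\mid X_0=i)$, $\mathbb E_i[\cdot]=\mathbb E[\cdot\mid X_0=i]$; $T_i=\inf\{t\ge1:X_t=i\}$. $x\in(1\pm\epsilon)y$ means $(1-\epsilon)y\le x\le(1+\epsilon)y$. Mixing quantities (finite $\Sigma$): $H_i=\max_{j\in\Sigma}\mathbb E_j[T_i]$; the fundamental matrix is $Z=(I-P+\mathbf 1\pi^T)^{-1}$, also written $Z=\sum_{t\ge0}(P^t-\mathbf 1\pi^T)$; $Z_{\max}(i)=\max_{k\in\Sigma}|Z_{ki}|$; $t_{\mathrm{mix}}=\min\{t:\max_{x\in\Sigma}\|P^t(x,\cdot)-\pi\|_{TV}\le1/4\}$ with $\|\cdot\|_{TV}$ total variation distance. Algorithm $\mathrm{IteratedRefinement}(i,\epsilon',\alpha)$ with accuracy parameter $\epsilon'$ (here used with $\epsilon'=\epsilon/2$): iterations $k=1,2,\dots$ with truncation thresholds $\theta^{(k)}=2^k$ and sample sizes $N^{(1)}=\lceil 6(1+\epsilon')\ln(8/\alpha)/\epsilon'^2\rceil$, $N^{(k+1)}=\lceil 3(1+\epsilon')\theta^{(k+1)}\ln(4\theta^{(k+1)}/\alpha)/(\hat T_i^{(k)}\epsilon'^2)\rceil$. In iteration $k$, $N^{(k)}$ fresh independent realizations of the chain started at $X_0=i$ are simulated, each stopped at the first time $t\ge1$ with $t=\theta^{(k)}$ or $X_t=i$;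 the $s$-th has length $t_s$ distributed as $\min(T_i,\theta^{(k)})$. Set $\hat T_i^{(k)}=\frac1{N^{(k)}}\sum_{s=1}^{N^{(k)}}t_s$ and $\hat\pi_i^{(k)}=1/\hat T_i^{(k)}$. The number of random walk steps in iteration $k$ is $N^{(k)}\hat T_i^{(k)}$. Notation: $\tilde O(f(a)g(b))=O(f(a)\,\mathrm{polylog} f(a))\,O(g(b)\,\mathrm{polylog} g(b))$; when two $O$- or $\tilde O$-expressions are joined by ''$=$'', the right one is a further upper bound for the left one.
   Formalization: The O and Õ bounds are stated for ε and α below absolute constants, uniformly over all chains, since they fail as ε or α tends to 1; bounds with t_mix assume t_mix exists and is positive; Z is the inverse (I−P+1π^T)^{-1}, as the series formula differs from it by 1π^T. *)

(* Defs.v *)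
From HB Require Import structures.
From mathcomp Require Import all_boot all_order all_algebra.
From mathcomp Require Import all_classical all_reals all_analysis.

Set Implicit Arguments.
Unset Strict Implicit.
Unset Printing Implicit Defensive.

Import Order.TTheory GRing.Theory Num.Theory.
Import numFieldNormedType.Exports.

Local Open Scope classical_set_scope.
Local Open Scope ring_scope.

(* The state space is 'I_n; a distribution on it is a row vector. *)

Definition stochastic (R : realType) (n : nat) (P : 'M[R]_n) : Prop :=
  (forall x y, 0 <= P x y) /\ (forall x, \sum_y P x y = 1).

Definition irreducible (R : realType) (n : nat) (P : 'M[R]_n) : Prop :=
  forall x y, exists t : nat, 0 < (P ^+ t) x y.

Definition stationary (R : realType) (n : nat) (P : 'M[R]_n) (pi : 'rV[R]_n) :
    Prop :=
  [/\ forall x, 0 <= pi 0 x, \sum_x pi 0 x = 1 & pi *m P = pi].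

Definition markov_chain (R : realType) (d : measure_display)
    (Om : measurableType d) (Pr : probability Om R)
    (n : nat) (P : 'M[R]_n) (j : 'I_n) (X : nat -> Om -> 'I_n) : Prop :=
  [/\ forall t x, measurable (X t @^-1` [set x]),
      Pr (X 0%N @^-1` [set j]) = 1%E
    & (* P(X_(t+1) = x_(t+1) | X_0 = x_0, ..., X_t = x_t) = P(x_t, x_(t+1)),
         multiplied out so that null conditioning events are harmless *)
      forall (t : nat) (x : nat -> 'I_n),
        Pr [set w | forall u, (u <= t.+1)%N -> X u w = x u] =
        (Pr [set w | forall u, (u <= t)%N -> X u w = x u]
           * (P (x t) (x t.+1))%:E)%E].

(* One process X under the laws P_j = P( . | X_0 = j). *)
Definition markov_family (R : realType) (d : measure_display)
    (Om : measurableType d) (n : nat) (PP : 'I_n -> probability Om R)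
    (P : 'M[R]_n) (X : nat -> Om -> 'I_n) : Prop :=
  forall j, markov_chain (PP j) P j X.

Definition sigma_process (d : measure_display) (Om : measurableType d)
    (n : nat) (X : nat -> Om -> 'I_n) : set_system Om :=
  <<s [set A | exists t x, A = X t @^-1` [set x]] >>.

Definition independent_processes (R : realType) (d : measure_display)
    (Om : measurableType d) (Pr : probability Om R)
    (I : choiceType) (n : nat) (Y : I -> nat -> Om -> 'I_n) : Prop :=
  forall (J : seq I) (A : I -> set Om), uniq J ->
    (forall j, j \in J -> sigma_process (Y j) (A j)) ->
    Pr (\bigcap_(j in [set` J]) A j) = (\prod_(j <- J) Pr (A j))%E.

(* T_i of a trajectory, +oo if i is not visited at any time t >= 1. *)
Definition return_time (R : realType) (n : nat) (i : 'I_n) (x : nat -> 'I_n) :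
    \bar R :=
  ereal_inf [set t%:R%:E | t in [set t : nat | (1 <= t)%N /\ x t = i]].

Definition mean_return_time (R : realType) (d : measure_display)
    (Om : measurableType d) (n : nat) (PP : 'I_n -> probability Om R)
    (X : nat -> Om -> 'I_n) (j i : 'I_n) : \bar R :=
  (\int[PP j]_w return_time R i (fun t => X t w))%E.

(* The maximum is finite for an irreducible chain on a finite state space. *)
Definition H_max (R : realType) (d : measure_display)
    (Om : measurableType d) (n : nat) (PP : 'I_n -> probability Om R)
    (X : nat -> Om -> 'I_n) (i : 'I_n) : R :=
  fine (\big[maxe/0%E]_(j < n) mean_return_time PP X j i).

Definition fundamental_mx (R : realType) (n : nat) (P : 'M[R]_n)
    (pi : 'rV[R]_n) : 'M[R]_n :=
  invmx (1%:M - P + (const_mx 1 : 'cV[R]_n) *m pi).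

Definition Zmax (R : realType) (n : nat) (P : 'M[R]_n) (pi : 'rV[R]_n)
    (i : 'I_n) : R :=
  \big[Num.max/0]_(k < n) `|fundamental_mx P pi k i|.

Definition tv_dist (R : realType) (n : nat) (mu nu : 'rV[R]_n) : R :=
  \big[Num.max/0]_(A : {set 'I_n}) `|\sum_(y in A) mu 0 y - \sum_(y in A) nu 0 y|.

Definition mixed (R : realType) (n : nat) (P : 'M[R]_n) (pi : 'rV[R]_n)
    (t : nat) : Prop :=
  \big[Num.max/0]_(x < n) tv_dist (row x (P ^+ t)) pi <= 4^-1.

(* tm is the mixing time.  A periodic chain has none (mixing time +oo); the
   mixing time is 0 exactly when there is a single state. *)
Definition is_tmix (R : realType) (n : nat) (P : 'M[R]_n) (pi : 'rV[R]_n)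
    (tm : nat) : Prop :=
  mixed P pi tm /\ forall t, mixed P pi t -> (tm <= t)%N.

Definition log2 (R : realType) (x : R) : R := ln x / ln 2.

Definition in_pm (R : realType) (eps x y : R) : Prop :=
  (1 - eps) * y <= x <= (1 + eps) * y.

Definition theta (k : nat) : nat := (2 ^ k)%N.

(* Least t in 1, ..., th with t = th or x t = i (for th >= 1): the position at
   which find stops is t - 1. *)
Definition stop_length (n : nat) (i : 'I_n) (th : nat) (x : nat -> 'I_n) : nat :=
  (find (fun t => (t == th) || (x t == i)) (iota 1 th)).+1.

(* The recursion is run on a stock x of trajectories: x k s is the s-th
   trajectory available to iteration k >= 1, which uses those with s < N k. *)
Section IteratedRefinement.
Context (R : realType) (n : nat) (i : 'I_n) (eps' alpha : R)
  (x : nat -> nat -> nat -> 'I_n).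

(* Both arguments of Num.ceil are positive in use. *)
Definition sample_size (k : nat) (T_prev : R) : nat :=
  if k == 1%N then
    `|Num.ceil (6 * (1 + eps') * ln (8 / alpha) / eps' ^+ 2)|%N
  else
    `|Num.ceil (3 * (1 + eps') * (theta k)%:R * ln (4 * (theta k)%:R / alpha)
                  / (T_prev * eps' ^+ 2))|%N.

Definition sample_mean (k N : nat) : R :=
  N%:R^-1 * \sum_(s < N) (stop_length i (theta k) (x k s))%:R.

(* Iterations are numbered from 1; the value at 0 is never used. *)
Fixpoint T_hat (k : nat) : R :=
  if k is k'.+1 then sample_mean k (sample_size k (T_hat k')) else 0.

Definition N_samples (k : nat) : nat := sample_size k (T_hat k.-1).

Definition pi_hat (k : nat) : R := (T_hat k)^-1.

(* Random walk steps simulated in iterations 1, ..., k. *)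
Definition steps (k : nat) : R :=
  \sum_(1 <= l < k.+1) (N_samples l)%:R * T_hat l.

End IteratedRefinement.

(* The generic member of soft-O(f_1 f_2 ... f_m), with one polylogarithmic
   correction per factor; a polynomial in ln f is dominated by a multiple of
   (1 + |ln f|)^c for some c, and conversely. *)
Definition softO (R : realType) (C : R) (c : nat) (fs : seq R) : R :=
  C * \prod_(f <- fs) (f * (1 + `|ln f|) ^+ c).

(* Main.v *)
Require Import Defs.
From HB Require Import structures.
From mathcomp Require Import all_boot all_order all_algebra.
From mathcomp Require Import all_classical all_reals all_analysis.
From mathcomp Require Import measurable_realfun ring lra zify.

(** Let S_t(x) be the probability that the chain started at x avoids i at the
    times 1, ..., t.  The column z = Z e_i of the fundamental matrix solves the
    Poisson equation (I - P) z = e_i - pi_i 1, so that E_x T_i = (z_i - z_x) / pi_i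
    for x <> i.  Markov's inequality gives S_b <= 1/2 for b = floor(2 H_i), hence
    S_t decays like 2^(- t / (2 H_i)), and the relative bias of the truncated mean
    mu_k = E_i min(T_i, 2^k) is at most 2 Zmax(i) S_{2^k}(i).

    Iteration k+1 is wrong with probability at most alpha / 2^(k+2) if the previous
    estimate is at most (1 + eps') mu_k, by a Chernoff bound applied to the fresh
    trajectories conditionally on the past; a union bound makes all estimates
    correct up to the factor 1 +- eps' with probability at least 1 - alpha / 2.
    On this event iteration k takes O(2^k ln(2^k / alpha) / eps^2) steps, a
    geometric sum.

    If the chain is mixed at time tm, P^tm halves the oscillation of a function, so
    the Poisson equation bounds the oscillation of z by 2 tm; hence
    Zmax(i) = O(tm) and H_i = O(tm / pi_i). *)

Set Implicit Arguments.
Unset Strict Implicit.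
Unset Printing Implicit Defensive.

Import Order.TTheory GRing.Theory Num.Theory.
Import numFieldNormedType.Exports.

Local Open Scope classical_set_scope.
Local Open Scope ring_scope.

(** * Hitting times and the fundamental matrix *)

(** The obstacle is that the sample size of iteration k+1 is random, being computed from the
    previous estimate. That estimate is a ratio of two naturals, total length and sample size, so
    the past splits into countably many events on which the next sample size is a constant. On each
    of them the tail bound multiplies the probability of the event, and summing over them replaces
    conditional expectation. An upper bound on the previous estimate makes the next sample large
    enough; a lower bound on it keeps the next sample from being too large. The tolerance is split
    evenly: eps / 2 for sampling and eps / 2 for the truncation bias, whence the argument 8 Zmax /
    eps of the logarithm. In the step bound, eps < 1/9 and alpha < 1/3 make ln (Zmax / eps) and ln
    (1 / alpha) at least 1, so that additive constants can be absorbed. *)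

Section NonnegativeMatrices.
Context (R : realType) (n : nat).
Implicit Types (A : 'M[R]_n) (v u : 'cV[R]_n).

Definition nonneg_mx A := forall x y, 0 <= A x y.

Lemma nonneg_mxX A t : nonneg_mx A -> nonneg_mx (A ^+ t).
Proof.
move=> A0; elim: t => [|t IH] x y; first by rewrite expr0 mxE ler0n.
by rewrite exprS mxE; apply: sumr_ge0 => z _; exact: mulr_ge0.
Qed.

Lemma nonneg_mulmx_le A u v : nonneg_mx A -> (forall x, u x 0 <= v x 0) ->
  forall x, (A *m u) x 0 <= (A *m v) x 0.
Proof.
move=> A0 uv x; rewrite !mxE; apply: ler_sum => y _.
exact: ler_wpM2l.
Qed.

Lemma nonneg_mulmx_ge0 A u : nonneg_mx A -> (forall x, 0 <= u x 0) ->
  forall x, 0 <= (A *m u) x 0.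
Proof. by move=> A0 u0 x; rewrite mxE sumr_ge0 // => y _; exact: mulr_ge0. Qed.

Lemma exprS_mulmx A t v : A ^+ t.+1 *m v = A *m (A ^+ t *m v).
Proof. by rewrite exprS -mulmxE mulmxA. Qed.

Lemma exprSr_mulmx A t v : A ^+ t.+1 *m v = A ^+ t *m (A *m v).
Proof. by rewrite exprSr -mulmxE mulmxA. Qed.

Lemma telescope_mulmx A v w T : v = w + A *m v ->
  v = \sum_(t < T) (A ^+ t *m w) + A ^+ T *m v.
Proof.
move=> vE; elim: T => [|T IH]; first by rewrite big_ord0 add0r expr0 mul1mx.
by rewrite big_ord_recr /= -addrA exprSr_mulmx -mulmxDr -vE.
Qed.

End NonnegativeMatrices.

Section StationaryChain.
Context (R : realType) (n : nat) (P : 'M[R]_n) (pi : 'rV[R]_n) (i : 'I_n).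
Hypotheses (stochP : stochastic P) (irrP : irreducible P)
  (statP : stationary P pi).

Let ones : 'cV[R]_n := const_mx 1.
Implicit Types (v u : 'cV[R]_n) (t : nat).


Lemma stochastic_nonneg : nonneg_mx P. Proof. by case: stochP. Qed.

Lemma stochastic_ones : P *m ones = ones.
Proof.
apply/matrixP => x y; rewrite !mxE; under eq_bigr do rewrite mxE mulr1.
by case: stochP.
Qed.

Lemma stochastic_mulmx_le v c t : (forall x, v x 0 <= c) ->
  forall x, (P ^+ t *m v) x 0 <= c.
Proof.
move=> vc; elim: t => [|t IH] x; first by rewrite expr0 mul1mx.
rewrite exprS_mulmx mxE; apply: le_trans (_ : \sum_y P x y * c <= c).
  by apply: ler_sum => y _; apply: ler_wpM2l => //; case: stochP.
by rewrite -mulr_suml; case: stochP => _ ->; rewrite mul1r.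
Qed.

Lemma stochastic_mulmx_ge v c t : (forall x, c <= v x 0) ->
  forall x, c <= (P ^+ t *m v) x 0.
Proof.
move=> vc x; have := @stochastic_mulmx_le (- v) (- c) t _ x.
by rewrite mulmxN mxE lerN2; apply => y; rewrite mxE lerN2.
Qed.

Lemma stationary_expr t : pi *m P ^+ t = pi.
Proof.
case: statP => _ _ piP; elim: t => [|t IH]; first by rewrite expr0 mulmx1.
by rewrite exprS -mulmxE mulmxA piP.
Qed.

Lemma stationary_ones : pi *m ones = 1%:M.
Proof.
apply/matrixP => x y; rewrite !ord1 !mxE; under eq_bigr do rewrite mxE mulr1.
by case: statP => _ ->; rewrite eqxx.
Qed.

Lemma stationary_gt0 : 0 < pi 0 i.
Proof.
case: (statP) => pi0 pi1 _.
have [k pik] : exists k, 0 < pi 0 k.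
  apply: contrapT => /forallNP npi.
  have := @ltr01 R; rewrite -pi1 big1 ?ltxx // => k _.
  apply/eqP; rewrite eq_le pi0 andbT leNgt; exact/negP/npi.
have [t Pt] := irrP k i.
have -> : pi 0 i = (pi *m P ^+ t) 0 i by rewrite stationary_expr.
rewrite mxE (bigD1 k) //= ltr_pwDl ?mulr_gt0 // sumr_ge0 // => y _.
by apply: mulr_ge0; [exact: pi0|exact/nonneg_mxX/stochastic_nonneg].
Qed.

Lemma stationary_le1 : pi 0 i <= 1.
Proof.
case: (statP) => pi0 <- _; rewrite (bigD1 i) //= lerDl sumr_ge0 //.
Qed.

(** Maximum principle: at a maximum point [m], [(P ^+ t *m v) m 0 = v m 0] is an average of values
    at most [v m 0], so every state of positive weight has the same value, and irreducibility
    reaches every state. *)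
Lemma harmonic_const v : P *m v = v -> forall x y, v x 0 = v y 0.
Proof.
move=> Pv.
have PvX t : P ^+ t *m v = v.
  by elim: t => [|t IH]; rewrite ?expr0 ?mul1mx // exprS_mulmx IH.
case: (@Order.TotalTheory.arg_maxP _ R _ i predT (fun x => v x 0) isT) =>
  m _ mP.
suff vm y : v y 0 = v m 0 by move=> x y; rewrite !vm.
have [t Pt] := irrP m y.
have Pt0 x : 0 <= (P ^+ t) m x by exact/nonneg_mxX/stochastic_nonneg.
have : \sum_x (P ^+ t) m x * (v m 0 - v x 0) = 0.
  under eq_bigr do rewrite mulrBr.
  rewrite sumrB -mulr_suml.
  have -> : \sum_x (P ^+ t) m x = 1.
    have o1 : P ^+ t *m ones = ones.
      by elim: (t) => [|u IH];
        rewrite ?expr0 ?mul1mx // exprS_mulmx IH stochastic_ones.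
    have : (P ^+ t *m ones) m 0 = 1 by rewrite o1 mxE.
    by rewrite mxE => <-; apply: eq_bigr => x _; rewrite mxE mulr1.
  by rewrite mul1r -[in X in X - _](PvX t) mxE subrr.
move/eqP; rewrite psumr_eq0; last first.
  by move=> x _; rewrite mulr_ge0 // subr_ge0; exact: mP.
move/allP => /(_ y (mem_index_enum _)) /=.
by rewrite mulf_eq0 gt_eqF //= subr_eq0 => /eqP.
Qed.

(** The kernel is trivial: multiplying by [pi] on the left leaves [pi *m u = 0], so [u] is harmonic,
    hence constant, and the constant is its mean 0. The transposition is there because row freeness
    concerns the left kernel. *)
Lemma fundamental_unit : (1%:M - P + (const_mx 1 : 'cV[R]_n) *m pi) \in unitmx.
Proof.
rewrite -unitmx_tr -row_free_unit; apply/inj_row_free => v.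
set M := (X in X^T) => /(congr1 trmx); rewrite trmx_mul trmxK trmx0 => Mv.
set u := v^T in Mv.
have Mu : u - P *m u + ones *m (pi *m u) = 0.
  by rewrite -[RHS]Mv /M mulmxDl mulmxBl mul1mx mulmxA.
have piu : pi *m u = 0.
  have := congr1 (mulmx pi) Mu; rewrite mulmx0 mulmxDr mulmxBr !mulmxA.
  case: (statP) => _ _ ->; rewrite subrr add0r stationary_ones.
  by rewrite -mulmxA mul1mx.
have Pu : P *m u = u.
  by move/eqP: Mu; rewrite piu mulmx0 addr0 subr_eq0 => /eqP <-.
suff u0 : u = 0 by rewrite -[v]trmxK -/u u0 trmx0.
apply/matrixP => x y; rewrite ord1.
have : (pi *m u) 0 0 = 0 by rewrite piu mxE.
rewrite mxE; under eq_bigr => k _ do rewrite (harmonic_const Pu k x).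
by rewrite -mulr_suml; case: (statP) => _ -> _; rewrite mul1r !mxE.
Qed.

Definition zcol : 'cV[R]_n := col i (fundamental_mx P pi).

Lemma zcol_eq : zcol - P *m zcol + ones *m (pi *m zcol) = delta_mx i 0.
Proof.
have := mulmxV fundamental_unit; rewrite -/(fundamental_mx P pi) => MZ.
have -> : delta_mx i 0 = col i (1%:M : 'M[R]_n).
  by apply/matrixP => x y; rewrite !mxE ord1 eqxx andbT.
by rewrite -MZ colE -mulmxA -colE -/zcol mulmxDl mulmxBl mul1mx mulmxA.
Qed.

Lemma stationary_zcol : pi *m zcol = (pi 0 i)%:M.
Proof.
have := congr1 (mulmx pi) zcol_eq; rewrite mulmxDr mulmxBr !mulmxA.
case: (statP) => _ _ ->;
  rewrite subrr add0r stationary_ones -mulmxA mul1mx => ->.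
apply/matrixP => x y; rewrite !ord1 -colE !mxE eqxx //.
Qed.

(** Written as a fixed point [v = w + A *m v], the form that [telescope_mulmx] iterates. *)
Lemma zcol_poisson : zcol = delta_mx i 0 - pi 0 i *: ones + P *m zcol.
Proof.
have := zcol_eq; rewrite stationary_zcol mul_mx_scalar => <-.
by rewrite addrK subrK.
Qed.

Lemma sum_stationary_zcol : \sum_k pi 0 k * zcol k 0 = pi 0 i.
Proof. by have := congr1 (fun A : 'M[R]_1 => A 0 0) stationary_zcol;
  rewrite !mxE. Qed.


Lemma zcol_step x :
  zcol x 0 - (P *m zcol) x 0 = (x == i)%:R - pi 0 i.
Proof.
by rewrite [in X in X - _]zcol_poisson !mxE andbT mulr1 addrK.
Qed.

Lemma normr_zcol_le x : `|zcol x 0| <= Zmax P pi i.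
Proof. by rewrite mxE;
  exact: (le_bigmax _ (fun k => `|fundamental_mx P pi k i|)). Qed.

Lemma Zmax_le c : 0 <= c -> (forall x, `|zcol x 0| <= c) -> Zmax P pi i <= c.
Proof.
move=> c0 zc; apply/bigmax_leP; split => // x _.
by have := zc x; rewrite mxE.
Qed.

(** The Poisson equation at [i] writes 1 as a sum of three terms, each at most [Zmax]. This lower
    bound keeps the logarithms of [Zmax / eps] away from 0. *)
Lemma Zmax_ge : 3^-1 <= Zmax P pi i.
Proof.
have z x : - Zmax P pi i <= zcol x 0 <= Zmax P pi i.
  by rewrite -ler_norml normr_zcol_le.
have piZ : pi 0 i <= Zmax P pi i.
  rewrite -[X in X <= _]sum_stationary_zcol.
  case: (statP) => pi0 pi1 _.
  apply: le_trans (_ : \sum_k pi 0 k * Zmax P pi i <= _).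
    by apply: ler_sum => k _; apply: ler_wpM2l => //; case/andP: (z k).
  by rewrite -mulr_suml pi1 mul1r.
have Pz : - Zmax P pi i <= (P *m zcol) i 0.
  rewrite -[P]expr1; apply: stochastic_mulmx_ge => x; by case/andP: (z x).
have := zcol_step i; rewrite eqxx mulr1n; case/andP: (z i); lra.
Qed.

(* The mean return times, read off column i of the fundamental matrix. *)
Definition hit x : R :=
  if x == i then (pi 0 i)^-1 else (zcol i 0 - zcol x 0) / pi 0 i.

(** Column [i] is erased, not row [i]: the walk may start at [i] and is killed on entering it, so
    visits count from time 1 on. *)
Definition taboo_mx : 'M[R]_n := \matrix_(x, y) (if y == i then 0 else P x y).

(* [surv t x] is the probability of no return to i up to time t from x. *)
Definition surv t x : R := (taboo_mx ^+ t *m ones) x 0.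

Let hcol : 'cV[R]_n := \col_x hit x.

(** The function [(z_i - z_k) / pi_i] of [k] vanishes at [i], so [taboo_mx] and [P] act alike on it
    and the Poisson equation applies. Off [i] this is the first-step equation; at [i] the source
    [1 - pi_i] turns the right-hand side into [1 / pi_i]. *)
Lemma hit_taboo : hcol = ones + taboo_mx *m hcol.
Proof.
have pi0 : pi 0 i != 0 by rewrite gt_eqF // stationary_gt0.
apply/matrixP => x y; rewrite ord1 !mxE.
have -> : \sum_k taboo_mx x k * hcol k 0 =
    \sum_k P x k * ((zcol i 0 - zcol k 0) / pi 0 i).
  apply: eq_bigr => k _; rewrite [taboo_mx _ _]mxE [hcol _ _]mxE /hit.
  by case: eqVneq => [->|_] //; rewrite subrr !(mul0r, mulr0).
have -> : \sum_k P x k * ((zcol i 0 - zcol k 0) / pi 0 i) =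
    (zcol i 0 - (P *m zcol) x 0) / pi 0 i.
  under eq_bigr do rewrite mulrA mulrBr.
  rewrite -mulr_suml sumrB -mulr_suml; case: stochP => _ ->.
  by rewrite mul1r [(P *m zcol) x 0]mxE.
have := zcol_step x; rewrite /hit; case: eqVneq => [->|xi] /= zs.
  have -> : (P *m zcol) i 0 = zcol i 0 - 1 + pi 0 i by rewrite -[zcol i
    0](subrK ((P *m zcol) i 0)) zs; ring.
  by field.
have -> : (P *m zcol) x 0 = zcol x 0 + pi 0 i.
  by rewrite -[zcol x 0](subrK ((P *m zcol) x 0)) zs; ring.
by field.
Qed.

Lemma taboo_nonneg : nonneg_mx taboo_mx.
Proof. by move=> x y; rewrite mxE; case: ifP => // _; case: stochP. Qed.

(* Minimum principle: a minimum of [zcol i 0 - zcol x 0] off i would break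
   the Poisson equation. *)
Lemma zcol_le_diag x : zcol x 0 <= zcol i 0.
Proof.
case: (@Order.TotalTheory.arg_maxP _ R _ i predT (fun x => zcol x 0) isT) =>
  m _ mP.
suff mi : m = i by rewrite -mi; exact: mP.
apply/eqP/negP => /negP mi; have := zcol_step m;
  rewrite (negbTE mi) sub0r => zs.
have : (P *m zcol) m 0 <= zcol m 0.
  by rewrite -[P]expr1; apply: stochastic_mulmx_le => y; exact: mP.
have := stationary_gt0; lra.
Qed.

Lemma hit_ge0 x : 0 <= hit x.
Proof.
rewrite /hit; have pi0 := stationary_gt0; case: ifP => _.
  by rewrite invr_ge0 ltW.
by apply: divr_ge0; [rewrite subr_ge0 zcol_le_diag|exact: ltW].
Qed.

Lemma surv0 x : surv 0 x = 1.
Proof. by rewrite /surv expr0 mul1mx mxE. Qed.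

Lemma surv_ge0 t x : 0 <= surv t x.
Proof.
apply: nonneg_mulmx_ge0 => [|y]; last by rewrite mxE.
exact/nonneg_mxX/taboo_nonneg.
Qed.

Lemma surv_decr t x : surv t.+1 x <= surv t x.
Proof.
rewrite /surv exprSr_mulmx; apply: nonneg_mulmx_le.
  exact/nonneg_mxX/taboo_nonneg.
move=> y; rewrite !mxE; case: stochP => P0 /(_ y) <-; apply: ler_sum => z _.
by rewrite !mxE mulr1; case: ifP.
Qed.

Lemma surv_le s t x : (s <= t)%N -> surv t x <= surv s x.
Proof.
by move=> /subnK <-; elim: (t - s)%N => // u; apply: le_trans; exact: surv_decr.
Qed.

Lemma hit_surv T x :
  hit x = \sum_(t < T) surv t x + (taboo_mx ^+ T *m hcol) x 0.
Proof.
have := telescope_mulmx T hit_taboo => /(congr1 (fun A : 'cV[R]_n => A x 0)).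
by rewrite [LHS]mxE mxE summxE.
Qed.

Lemma sum_surv_le T x : \sum_(t < T) surv t x <= hit x.
Proof.
rewrite (hit_surv T) lerDl nonneg_mulmx_ge0 //.
  exact/nonneg_mxX/taboo_nonneg.
by move=> y; rewrite mxE hit_ge0.
Qed.

(** Survival decreases in time, so each of the first [T + 1] terms of the series for [hit] dominates
    [surv T]. Having [T + 1] rather than [T] here is what makes floor(2 H) steps enough to halve the
    survival. *)
Lemma surv_markov T x : T.+1%:R * surv T x <= hit x.
Proof.
apply: le_trans (sum_surv_le T.+1 x).
rewrite mulr_natl -[X in _ *+ X](card_ord T.+1) -sumr_const.
by apply: ler_sum => t _; apply: surv_le; rewrite -ltnS.
Qed.

Definition hit_max : R := \big[Num.max/0]_x hit x.

Lemma hit_le_max x : hit x <= hit_max.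
Proof. exact: (le_bigmax _ hit). Qed.

Lemma hit_ge1 x : 1 <= hit x.
Proof. by have := sum_surv_le 1 x; rewrite big_ord1 surv0. Qed.

Lemma hit_max_ge1 : 1 <= hit_max.
Proof. exact: le_trans (hit_ge1 i) (hit_le_max i). Qed.

Lemma taboo_mulmx_le t v c x : (forall y, v y 0 <= c) ->
  (taboo_mx ^+ t *m v) x 0 <= c * surv t x.
Proof.
move=> vc; apply: le_trans (_ : (taboo_mx ^+ t *m (c *: ones)) x 0 <= _).
  apply: nonneg_mulmx_le; first exact/nonneg_mxX/taboo_nonneg.
  by move=> y; rewrite !mxE mulr1.
by rewrite -scalemxAr mxE.
Qed.

Lemma hit_tail T x : hit x - \sum_(t < T) surv t x <= hit_max * surv T x.
Proof.
rewrite (hit_surv T) addrC addrA addNr add0r.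
by apply: taboo_mulmx_le => y; rewrite mxE hit_le_max.
Qed.

Lemma surv_add s t x c : (forall y, surv t y <= c) ->
  surv (s + t) x <= c * surv s x.
Proof.
move=> sc; rewrite /surv exprD -mulmxE -mulmxA.
exact: taboo_mulmx_le.
Qed.

Lemma surv_block b m x : 2 * hit_max <= b.+1%:R ->
  surv (m * b) x <= 2^-1 ^+ m.
Proof.
move=> Hb; elim: m x => [|m IH] x; first by rewrite mul0n surv0 expr0.
rewrite mulSn; apply: le_trans (surv_add _ _ IH) _.
rewrite exprSr ler_wpM2l ?exprn_ge0 ?invr_ge0 //.
rewrite -(@ler_pM2l _ b.+1%:R) ?ltr0n //.
apply: le_trans (surv_markov _ _) _.
rewrite -(@ler_pM2r _ 2) // -mulrA mulVf // mulr1 mulrC.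
apply: le_trans Hb; rewrite ler_pM2l //; exact: hit_le_max.
Qed.

(* Only the states other than i, where [hit] is bounded by
   [2 Zmax / pi_i], are reachable by the taboo chain. *)
Lemma trunc_return t : (0 < t)%N ->
  1 - pi 0 i * \sum_(u < t) surv u i <= 2 * Zmax P pi i * surv t i.
Proof.
case: t => // t _; have pi0 := stationary_gt0.
have -> : 1 - pi 0 i * \sum_(u < t.+1) surv u i =
    pi 0 i * (taboo_mx ^+ t.+1 *m hcol) i 0.
  have := hit_surv t.+1 i; rewrite {1}/hit eqxx => h.
  by rewrite -[1](divff (lt0r_neq0 pi0)) h mulrDr addrC addKr.
pose w : 'cV[R]_n := \col_x (if x == i then 0 else hit x).
have -> : taboo_mx ^+ t.+1 *m hcol = taboo_mx ^+ t.+1 *m w.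
  rewrite !exprSr_mulmx; congr (_ *m _); apply/matrixP => x y.
  rewrite !mxE; apply: eq_bigr => k _; rewrite !mxE.
  by case: eqVneq; rewrite ?mul0r.
rewrite -ler_pdivlMl // mulrA; apply: taboo_mulmx_le => y.
rewrite mxE; case: eqVneq => [_|yi].
  by rewrite mulr_ge0 ?invr_ge0 ?(ltW pi0) // mulr_ge0 // ltW // (lt_le_trans _
    Zmax_ge).
rewrite /hit (negbTE yi) mulrC; apply: ler_wpM2l; first by rewrite invr_ge0 ltW.
have := normr_zcol_le y; have := normr_zcol_le i.
rewrite !ler_norml; lra.
Qed.

(** * Oscillation of the fundamental matrix and the mixing time *)

Section Mixing.
Variable tm : nat.
Hypothesis mixtm : mixed P pi tm.

Lemma mixed_rows x y (A : {set 'I_n}) :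
  \sum_(k in A) (P ^+ tm) x k - \sum_(k in A) (P ^+ tm) y k <= 2^-1.
Proof.
have tv z : `|\sum_(k in A) (P ^+ tm) z k - \sum_(k in A) pi 0 k| <= 4^-1.
  apply: le_trans mixtm.
  apply: le_trans (le_bigmax _ (fun z => tv_dist (row z (P ^+ tm)) pi) z).
  apply: le_trans (le_bigmax _ (fun B : {set 'I_n} =>
    `|\sum_(k in B) row z (P ^+ tm) 0 k
    - \sum_(k in B) pi 0 k|) A).
  by under [in X in _ <= X]eq_bigr do rewrite mxE.
have := tv x; have := tv y; rewrite !ler_norml; lra.
Qed.

(** The two rows have equal mass, so [v] may be shifted by [a] to become nonnegative. Keeping only
    the states where the weight difference is nonnegative leaves [b - a] times the difference of two
    probabilities of one set. *)
Lemma mixed_contract v a b : (forall x, a <= v x 0 <= b) ->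
  forall x y, (P ^+ tm *m v) x 0 - (P ^+ tm *m v) y 0 <= 2^-1 * (b - a).
Proof.
move=> vab x y.
pose s k := (P ^+ tm) x k - (P ^+ tm) y k.
have s0 : \sum_k s k = 0.
  have row1 z : \sum_k (P ^+ tm) z k = 1.
    apply/eqP; rewrite eq_le;
      have e z' : \sum_k (P ^+ tm) z' k = (P ^+ tm *m ones) z' 0.
      by rewrite mxE; apply: eq_bigr => k _; rewrite mxE mulr1.
    rewrite e; apply/andP; split.
      by apply: stochastic_mulmx_le => k; rewrite mxE.
    by apply: stochastic_mulmx_ge => k; rewrite mxE.
  by rewrite /s sumrB !row1 subrr.
have -> : (P ^+ tm *m v) x 0 - (P ^+ tm *m v) y 0 = \sum_k s k * (v k 0 - a).
  under [RHS]eq_bigr do rewrite mulrBr.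
  rewrite sumrB -mulr_suml s0 mul0r subr0 !mxE -sumrB.
  by apply: eq_bigr => k _; rewrite mulrBl.
pose A := [set k | 0 <= s k]%SET.
apply: le_trans (_ : \sum_(k in A) s k * (b - a) <= _).
  rewrite (bigID (mem A)) /= -[X in _ <= X]addr0; apply: lerD.
    apply: ler_sum => k; rewrite inE => sk; apply: ler_wpM2l => //.
    by rewrite lerD2r; case/andP: (vab k).
  apply: sumr_le0 => k; rewrite inE -ltNge => sk.
  by rewrite nmulr_rle0 // subr_ge0; case/andP: (vab k).
rewrite -mulr_suml ler_wpM2r //.
  by rewrite subr_ge0; case/andP: (vab x); apply: le_trans.
by rewrite sumrB; exact: mixed_rows.
Qed.

(** After [tm] iterations of the Poisson equation, the [tm] source terms oscillate by at most 1 each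
    and the remainder by half the oscillation of [zcol]; solving [osc <= tm + osc / 2] gives the
    bound. *)
Lemma zcol_osc x y : zcol x 0 - zcol y 0 <= 2 * tm%:R.
Proof.
case: (@Order.TotalTheory.arg_maxP _ R _ i predT (fun x => zcol x 0) isT) =>
  M _ MP.
case: (@Order.TotalTheory.arg_minP _ R _ i predT (fun x => zcol x 0) isT) =>
  m _ mP.
have {MP mP} [zM zm] : (forall k, zcol k 0 <=
  zcol M 0) /\ (forall k, zcol m 0 <= zcol k 0).
  by split=> k; [exact: MP|exact: mP].
suff : zcol M 0 - zcol m 0 <= 2 * tm%:R by have := zM x; have := zm y; lra.
pose ei : 'cV[R]_n := delta_mx i 0.
have e k : zcol k 0 = \sum_(t < tm) ((P ^+ t *m ei) k 0 - pi 0 i)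
    + (P ^+ tm *m zcol) k 0.
  have := telescope_mulmx tm zcol_poisson => /(congr1 (fun A : 'cV[R]_n =>
    A k 0)).
  move=> ->; rewrite mxE summxE; congr (_ + _); apply: eq_bigr => t _.
  rewrite mulmxBr -scalemxAr.
  have -> : P ^+ t *m ones = ones.
    by elim: (nat_of_ord t) => [|u IH];
      rewrite ?expr0 ?mul1mx // exprS_mulmx IH stochastic_ones.
  by rewrite [LHS]mxE [X in _ + X = _]mxE [X in _ - X = _]mxE [ones k 0]mxE
    mulr1.
have c : (P ^+ tm *m zcol) M 0 - (P ^+ tm *m zcol) m 0 <=
    2^-1 * (zcol M 0 - zcol m 0).
  by apply: mixed_contract => k; rewrite zm zM.
have s : \sum_(t < tm) ((P ^+ t *m ei) M 0 - pi 0 i)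
   - \sum_(t < tm) ((P ^+ t *m ei) m 0 - pi 0 i) <= tm%:R.
  rewrite -sumrB -[X in _ <= X%:R](card_ord tm) -sumr_const.
  apply: ler_sum => t _.
  have /= := @stochastic_mulmx_le ei 1 t _ M.
  have /= := @stochastic_mulmx_ge ei 0 t _ m.
  have d k : 0 <= ei k 0 <= 1.
    by rewrite mxE ler0n lern1 leq_b1.
  move=> /(_ (fun k => proj1 (andP (d k)))) h0 /(_ (fun k =>
    proj2 (andP (d k)))).
  by move: h0; lra.
by move: (e M) (e m) c s; lra.
Qed.

(** The mean of [zcol] under [pi] is [pi_i], which lies in [0, 1], so its values exceed the
    oscillation by at most 1 in modulus. *)
Lemma Zmax_le_mix : Zmax P pi i <= 2 * tm%:R + 1.
Proof.
apply: Zmax_le => [|x]; first by rewrite addr_ge0 // mulr_ge0.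
have zd : `|zcol x 0 - pi 0 i| <= 2 * tm%:R.
  have [pi0 pi1 _] := statP.
  have -> : zcol x 0 - pi 0 i = \sum_k pi 0 k * (zcol x 0 - zcol k 0).
    under eq_bigr do rewrite mulrBr.
    by rewrite sumrB -mulr_suml pi1 mul1r sum_stationary_zcol.
  apply: le_trans (ler_norm_sum _ _ _) _.
  apply: le_trans (_ : \sum_k pi 0 k * (2 * tm%:R) <= _).
    apply: ler_sum => k _; rewrite normrM ger0_norm ?pi0 //.
    apply: ler_wpM2l; first exact: pi0.
    have := zcol_osc x k; have := zcol_osc k x; rewrite ler_norml; lra.
  by rewrite -mulr_suml pi1 mul1r.
have := stationary_gt0; have := stationary_le1.
move: zd; rewrite !ler_norml; lra.
Qed.

Lemma hit_max_le_mix : (0 < tm)%N -> hit_max <= 2 * tm%:R / pi 0 i.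
Proof.
move=> tm0; have pi0 := stationary_gt0.
have tm1 : 1 <= tm%:R :> R by rewrite ler1n.
apply/bigmax_leP; split => [|x _].
  by rewrite divr_ge0 ?(ltW pi0) // mulr_ge0.
rewrite /hit; case: ifP => _.
  by rewrite ler_pdivlMr // mulVf ?gt_eqF //; lra.
by rewrite ler_wpM2r ?invr_ge0 ?(ltW pi0) // zcol_osc.
Qed.

End Mixing.

End StationaryChain.

(** * Laws of trajectories *)

Section RealValuedProbability.
Context (R : realType) (d : measure_display) (Om : measurableType d)
  (Pr : probability Om R).
Implicit Types A B : set Om.

Definition prob A : R := fine (Pr A).

Lemma probE A : measurable A -> Pr A = (prob A)%:E.
Proof. by move=> mA; rewrite /prob fineK // fin_num_measure. Qed.

Lemma prob_ge0 A : 0 <= prob A.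
Proof. by rewrite /prob fine_ge0 // measure_ge0. Qed.

Lemma prob_setT : prob setT = 1.
Proof. by rewrite /prob probability_setT. Qed.

Lemma prob_set0 : prob set0 = 0.
Proof. by rewrite /prob measure0. Qed.

Lemma le_prob A B : measurable A -> measurable B -> A `<=` B -> prob A <=
  prob B.
Proof.
move=> mA mB AB; rewrite -lee_fin -!probE //; apply: le_measure => //;
  exact: mem_set.
Qed.

Lemma prob_partition_cap (T : finType) (f : Om -> T) A :
  (forall v, measurable (A `&` f @^-1` [set v])) ->
  prob A = \sum_v prob (A `&` f @^-1` [set v]).
Proof.
move=> mAf.
have AE : A = \bigcup_(v in [set: T]) (A `&` f @^-1` [set v]).
  apply/seteqP; split => [w Aw|w [v _ []]] //.
  by exists (f w).
have mA : measurable A by rewrite AE; apply: fin_bigcup_measurable.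
apply/EFin_inj; rewrite -probE // {1}AE measure_fin_bigcup //; last 2 first.
  exact: finite_finset.
  by move=> u v _ _ [w [[_ /= <-] [_ /= <-]]].
rewrite (_ : [set: T] = [set` index_enum T]) -?fsbig_seq ?index_enum_uniq //.
  by rewrite -sumEFin; apply: eq_bigr => v _; exact: probE.
by apply/seteqP; split => // v _; exact: mem_index_enum.
Qed.

Lemma prob_partition (T : finType) (f : Om -> T) A : measurable A ->
  (forall v, measurable (f @^-1` [set v])) ->
  prob A = \sum_v prob (A `&` f @^-1` [set v]).
Proof.
by move=> mA mf; apply: prob_partition_cap => v; exact: measurableI.
Qed.

Lemma prob_setU2 A B : measurable A -> measurable B ->
  prob (A `|` B) <= prob A + prob B.
Proof.
move=> mA mB; rewrite -lee_fin EFinD -!probE //; last exact: measurableU.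
exact: measureU2.
Qed.

Section CountablePartition.
Context (T : countType) (f : Om -> T).

(** Values are numbered by [pickle] so that countable additivity applies as a series over the
    naturals; a number that codes no value gives an empty fibre. *)
Let fibre k : set Om := [set w | pickle (f w) = k].

Lemma pickle_fibre k :
  (exists v, fibre k = f @^-1` [set v]) \/ fibre k = set0.
Proof.
case: (pselect (exists v : T, pickle v = k)) => [[v <-]|nv].
  left; exists v; rewrite /fibre.
  by apply/seteqP; split => w /= => [/(pcan_inj pickleK)|->].
by right; apply/seteqP; split => // w /= fw; apply: nv; exists (f w).
Qed.

Let fibre_cover A : A = \bigcup_k (A `&` fibre k).
Proof. by apply/seteqP; split => [w Aw|w [k _ []]] //; exists (pickle (f w)).
Qed.

Let measurable_fibre A : (forall v, measurable (A `&` f @^-1` [set v])) ->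
  forall k, measurable (A `&` fibre k).
Proof.
by move=> mAf k; case: (pickle_fibre k) => [[v ->]|->]; rewrite ?setI0.
Qed.

Lemma measurable_partition A : (forall v, measurable (A `&` f @^-1` [set v])) ->
  measurable A.
Proof.
move=> mAf; rewrite (fibre_cover A); apply: bigcup_measurable => k _.
exact: measurable_fibre.
Qed.

Lemma prob_series_partition A : (forall v, measurable (A `&` f @^-1` [set v]))
  ->
  Pr A = (\sum_(0 <= k <oo) (prob (A `&` [set w | pickle (f w) = k]))%:E)%E.
Proof.
move=> mAf; have mA := measurable_fibre mAf.
rewrite {1}(fibre_cover A) measure_semi_bigcup //.
- by apply: eq_eseriesr => k _; exact: probE.
- by move=> k l _ _ [w [[_ /= <-] [_ /= <-]]].
- by apply: bigcup_measurable.
Qed.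

(** Stands in for conditioning on [f]: the bound on each fibre is multiplied out, which covers null
    fibres, and is then averaged over the values of [f]. *)
Lemma prob_le_fibres A (c : R) : 0 <= c ->
  (forall v, measurable (f @^-1` [set v])) ->
  (forall v, measurable (A `&` f @^-1` [set v])) ->
  (forall v, prob (A `&` f @^-1` [set v]) <= prob (f @^-1` [set v]) * c) ->
  prob A <= c.
Proof.
move=> c0 mf mAf Af.
have mT v : measurable (setT `&` f @^-1` [set v]) by rewrite setTI.
have T1 := prob_series_partition mT.
rewrite -lee_fin -(probE (measurable_partition mAf)) (prob_series_partition
  mAf).
rewrite -[leRHS]mule1 -(probability_setT Pr) T1 -nneseriesZl; last first.
  by move=> k _; rewrite lee_fin prob_ge0.
apply: lee_nneseries => [k _ _|k _]; rewrite ?lee_fin ?prob_ge0 //.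
rewrite setTI -/(fibre k).
by rewrite mulrC; case: (pickle_fibre k) => [[v ->]|->] //;
  rewrite setI0 prob_set0 mul0r.
Qed.

End CountablePartition.

Lemma prob_cap1 A B : measurable A -> measurable B -> prob B = 1 ->
  prob (A `&` B) = prob A.
Proof.
move=> mA mB B1; apply/eqP; rewrite eq_le le_prob //; last exact: measurableI.
rewrite /=; have mC : measurable (~` B) by exact: measurableC.
have C0 : prob (~` B) = 0.
  by rewrite /prob probability_setC // probE // B1 /= subrr.
rewrite -[X in _ <= X]addr0 -C0; apply: le_trans (prob_setU2 _ _) => //;
  last exact: measurableI.
apply: le_prob => //; first by apply: measurableU => //; exact: measurableI.
by move=> w Aw; case: (pselect (B w)) => Bw; [left|right].
Qed.

End RealValuedProbability.

(** * Avoidance probabilities as powers of the taboo matrix *)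

Section MarkovChain.
Context (R : realType) (d : measure_display) (Om : measurableType d)
  (Pr : probability Om R) (n : nat) (P : 'M[R]_n) (j : 'I_n)
  (X : nat -> Om -> 'I_n).
Hypothesis mcX : markov_chain Pr P j X.

Lemma markov_chain_measurable t x : measurable (X t @^-1` [set x]).
Proof. by case: mcX. Qed.

Lemma markov_chain_measurable_in t (b : pred 'I_n) : measurable [set w | b (X t
  w)].
Proof.
rewrite (_ : [set w | _] = \bigcup_(x in [set x | b x]) X t @^-1` [set x]).
  by apply: fin_bigcup_measurable => // x _; exact: markov_chain_measurable.
apply/seteqP; split => [w /= bw|w [x /= bx wx]]; first by exists (X t w).
by rewrite wx.
Qed.

(* Relaxing the prescribed states one at a time, from time 0 on, turns the path
   formula into the Markov property for such events. *)
Let cyl (b : nat -> pred 'I_n) s t (x : nat -> 'I_n) : set Om :=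
  [set w | (forall u, (u < s)%N -> b u (X u w)) /\
           (forall u, (s <= u <= t)%N -> X u w = x u)].

Let measurable_cyl b s t x : measurable (cyl b s t x).
Proof.
rewrite (_ : cyl b s t x =
    (\bigcap_(u in [set u | (u < s)%N]) [set w | b u (X u w)]) `&`
    (\bigcap_(u in [set u | (s <= u <= t)%N]) X u @^-1` [set x u])).
  apply: measurableI; apply: bigcap_measurableType => u _.
    exact: markov_chain_measurable_in.
  exact: markov_chain_measurable.
by apply/seteqP; split => w [].
Qed.

Let cyl_step b s t x : (s <= t)%N ->
  prob Pr (cyl b s t.+1 x) = prob Pr (cyl b s t x) * P (x t) (x t.+1).
Proof.
elim: s x => [|s IH] x st.
  have [_ _ H] := mcX.
  have cE v : cyl b 0 v x = [set w | forall u, (u <= v)%N -> X u w = x u].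
    by apply/seteqP; split => [w [_ ?]|w /= ?]; [|split].
  by rewrite /prob !cE H fineM // -?cE fin_num_measure.
(* Only the state at time [s] is replaced; since [s < t] where this is used, the last transition is
   unaffected. *)
pose upd v u := if u == s then v else x u.
have split_cyl v : (s < v)%N -> prob Pr (cyl b s.+1 v x) =
    \sum_(y | b s y) prob Pr (cyl b s v (upd y)).
  move=> sv; rewrite (prob_partition Pr (measurable_cyl _ _ _ _)
    (markov_chain_measurable s)).
  rewrite [RHS]big_mkcond; apply: eq_bigr => y _; case: ifPn => by_.
    congr (prob Pr _); apply/seteqP; split => w /=.
      move=> [[wb wx] wy]; split => [u us|u]; first exact/wb/ltnW.
      rewrite /upd; case: eqVneq => [->//|us /andP[su uv]].
      by apply: wx; rewrite uv andbT ltn_neqAle eq_sym us.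
    move=> [wb wx]; have ws : X s w = y by rewrite wx ?leqnn ?(ltnW sv) // /upd
      eqxx.
    split => //; split => [u|u /andP[su uv]].
      by rewrite ltnS leq_eqVlt => /orP[/eqP ->|/wb//]; rewrite ws.
    by rewrite wx ?(ltnW su) // /upd gtn_eqF.
  rewrite (_ : _ `&` _ = set0) ?prob_set0 //.
  apply/seteqP; split => // w [[/(_ s (leqnn _)) bs _] /= ws].
  by move: bs; rewrite ws (negbTE by_).
rewrite !split_cyl // ?mulr_suml; last exact: ltnW.
apply: eq_bigr => y _; rewrite IH ?(ltnW st) // /upd.
by rewrite !gtn_eqF // ltnW.
Qed.

Lemma prob_start x : prob Pr (X 0%N @^-1` [set x]) = (x == j)%:R.
Proof.
have [_ X0 _] := mcX.
case: eqVneq => [->|xj]; first by rewrite /prob X0.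
rewrite -(@prob_cap1 _ _ _ Pr _ (X 0%N @^-1` [set j])) /prob ?X0 //.
- rewrite (_ : _ `&` _ = set0) ?measure0 //.
  apply/seteqP; split => // w [/= -> jx]; by rewrite jx eqxx in xj.
- exact: markov_chain_measurable.
- exact: markov_chain_measurable.
Qed.

Context (i : 'I_n).

Definition no_return t : set Om :=
  [set w | forall u, (0 < u <= t)%N -> X u w != i].

Lemma measurable_no_return t : measurable (no_return t).
Proof.
rewrite (_ : no_return t = \bigcap_(u in [set u | (0 < u <=
  t)%N]) [set w | X u w != i]).
  apply: bigcap_measurableType => u _.
  exact: (markov_chain_measurable_in u (predC1 i)).
by apply/seteqP; split => w.
Qed.

Let prob_no_return_at t x :
  prob Pr (no_return t `&` X t @^-1` [set x]) = (taboo_mx P i ^+ t) j x.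
Proof.
(* Time 0 is unconstrained, because a return is counted from time 1 on. *)
pose b u : pred 'I_n := if u is 0%N then predT else predC1 i.
have noE v y : no_return v `&` X v @^-1` [set y] =
    if b v y then cyl b v v (fun=> y) else set0.
  case: ifPn => bv; apply/seteqP; split => // w.
  - move=> [nw wy]; split => [u uv|u /anti_leq <- //].
    case: u uv => // u uv; apply: (nw u.+1); apply/andP; split => //;
      exact: ltnW.
  - move=> [wb wx]; have wv : X v w = y by apply: wx; rewrite leqnn.
    split => // u /andP[u0]; rewrite leq_eqVlt => /orP[/eqP uv|/wb].
      by move: u0 bv; rewrite uv wv; case: (v).
    by case: u u0.
  - move=> [nw wy]; case: v bv nw wy => // v /negPn /eqP -> /(_ v.+1) + vi.
    by rewrite leqnn vi eqxx => /(_ isT).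
elim: t x => [|t IH] x.
  rewrite expr0 mxE [no_return 0](_ : _ = setT) ?setTI ?prob_start 1?eq_sym //.
  by apply/seteqP; split => // w _ u; case: u.
rewrite noE /= exprSr mxE; case: eqVneq => [->|xi] /=.
  by rewrite prob_set0 big1 // => y _; rewrite !mxE eqxx mulr0.
rewrite (prob_partition Pr (measurable_cyl _ _ _ _) (markov_chain_measurable
  t)).
apply: eq_bigr => y _; rewrite !mxE (negbTE xi) -IH noE.
case: ifPn => bty.
  pose z u := if u == t then y else x.
  have -> : cyl b t.+1 t.+1 (fun=> x) `&` X t @^-1` [set y] = cyl b t t.+1 z.
    apply/seteqP; split => w.
      move=> [[wb wx] wy]; split => [u ut|u]; first exact/wb/ltnW.
      rewrite /z; case: eqVneq => [->//|ut /andP[tu ut1]].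
      by apply: wx; rewrite ut1 andbT ltn_neqAle eq_sym ut.
    move=> [wb wx]; have wt : X t w = y by rewrite wx ?leqnn ?leqnSn // /z eqxx.
    split => //; split => [u|u /andP[tu ut]].
      by rewrite ltnS leq_eqVlt => /orP[/eqP ->|/wb//]; rewrite wt.
    by rewrite wx ?(ltnW tu) // /z gtn_eqF.
  rewrite cyl_step // {2 3}/z eqxx gtn_eqF //; congr (prob Pr _ * _).
  by apply/seteqP; split => w [wb wx]; split => // u /[dup] /anti_leq ut /wx ->;
    rewrite /z -ut eqxx.
rewrite prob_set0 mul0r (_ : _ `&` _ = set0) ?prob_set0 //.
apply/seteqP; split => // w [[/(_ t (leqnn _)) bw _] /= ws].
by move: bw; rewrite ws (negbTE bty).
Qed.

Lemma prob_no_return t : prob Pr (no_return t) = surv P i t j.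
Proof.
rewrite (prob_partition Pr (measurable_no_return t) (markov_chain_measurable
  t)).
rewrite /surv mxE; apply: eq_bigr => y _.
by rewrite prob_no_return_at mxE mulr1.
Qed.

End MarkovChain.

(** * Return and stopping times through their tails *)

Section ReturnTime.
Context (R : realType) (n : nat) (i : 'I_n).
Implicit Type x : nat -> 'I_n.

Definition avoids x t : bool := `[< forall u, (0 < u <= t)%N -> x u != i >].

Lemma avoidsP x t : reflect (forall u, (0 < u <= t)%N -> x u != i) (avoids x t).
Proof. exact: asboolP. Qed.

(** Pointwise tail-sum formula: [T_i] is the number of [t] with [T_i > t], which includes the value
    +oo when [i] is never visited. *)
Lemma return_time_series x :
  return_time R i x = (\sum_(0 <= t <oo) ((avoids x t)%:R : R)%:E)%E.
Proof.
apply/esym; case: (pselect (exists t, (0 < t)%N && (x t == i))) => [ex|nex].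
  case: (ex_minnP ex) => m /andP[m0 /eqP xm] minm.
  have av t : avoids x t = (t < m)%N.
    apply/avoidsP/idP => [xt|tm u /andP[u0 ut]].
      by rewrite ltnNge; apply/negP => mt; have := xt m;
        rewrite m0 mt xm eqxx => /(_ isT).
    apply/negP => xu; have := minm u; rewrite u0 xu => /(_ isT).
    by rewrite leqNgt (leq_ltn_trans ut tm).
  transitivity (m%:R%:E : \bar R).
    apply: cvg_lim => //; apply: cvg_near_cst; exists m => // k /= mk.
    rewrite sumEFin (@big_cat_nat _ _ _ m) //=; congr EFin.
    rewrite [X in _ + X = _]big_nat_cond [X in _ + X = _]big1 ?addr0;
      last first.
      by move=> t /andP[/andP[mt _] _]; rewrite av ltnNge mt.
    under eq_big_nat => t /andP[_ tm] do rewrite av tm.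
    by rewrite big_const_nat subn0 iter_addr addr0.
  rewrite /return_time; apply/eqP; rewrite eq_le; apply/andP; split.
    apply: le_ereal_inf_tmp => _ [t [t0 xt] <-]; rewrite lee_fin ler_nat.
    by apply: minm; rewrite t0 xt eqxx.
  by apply: ereal_inf_lbound; exists m.
have av t : avoids x t.
  apply/avoidsP => u /andP[u0 _]; apply/negP => xu; apply: nex; exists u.
  by rewrite u0.
have -> : return_time R i x = +oo%E.
  rewrite /return_time -(ereal_inf0 R); congr ereal_inf.
  apply/seteqP; split => // y [t [t0 xt] _]; apply: nex; exists t.
  by rewrite t0 xt eqxx.
apply: cvg_lim => //.
rewrite (_ : (fun k => _) = (fun k => k%:R%:E)); first exact/cvgenyP/cvg_id.
apply/funext => k; rewrite sumEFin; congr EFin.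
under eq_bigr do rewrite av.
by rewrite big_const_nat subn0 iter_addr addr0.
Qed.

Lemma stop_length_gt th x t : (0 < th)%N ->
  (t < stop_length i th x)%N = (t < th)%N && avoids x t.
Proof.
move=> th0; rewrite /stop_length ltnS.
set a := (fun t => _); set s := iota 1 th.
(* The list ends with [th], which satisfies the test, so the search never runs off its end. *)
have ha : has a s.
  by apply/hasP; exists th;
    rewrite ?mem_iota ?add1n ?ltnS ?leqnn ?th0 // /a eqxx.
have fth : (find a s < th)%N by have := ha; rewrite has_find size_iota.
have af : a (find a s).+1 by have := nth_find 0%N ha; rewrite nth_iota.
have nf u : (u < find a s)%N -> a u.+1 = false.
  move=> uf; have := before_find 0%N uf; rewrite nth_iota ?add1n //.
  exact: ltn_trans fth.
apply/idP/andP => [tf|[tth /avoidsP xt]].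
  split; first exact: leq_ltn_trans fth.
  apply/avoidsP => -[//|u] /= ut; have := nf u (leq_trans ut tf).
  by rewrite /a => /negbT; rewrite negb_or => /andP[].
rewrite leqNgt; apply/negP => ft; move: af; rewrite /a => /orP[/eqP fE|xf].
  by move: ft; rewrite ltnNge -ltnS fE tth.
by have := xt (find a s).+1; rewrite ft xf => /(_ isT).
Qed.

Lemma stop_length_le th x : (0 < th)%N -> (stop_length i th x <= th)%N.
Proof. by move=> th0; rewrite leqNgt stop_length_gt // ltnn. Qed.

End ReturnTime.

Section MeanReturnTime.
Context (R : realType) (n : nat) (P : 'M[R]_n) (pi : 'rV[R]_n) (i : 'I_n).
Hypotheses (stochP : stochastic P) (irrP : irreducible P)
  (statP : stationary P pi).

(** The remainder is at most [M * surv k], and [surv k <= M / (k + 1)] by Markov's inequality, hence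
    the harmonic error with factor [M ^+ 2]. *)
Lemma cvg_sum_surv x :
  (\sum_(0 <= t < k) surv P i t x) @[k --> \oo] --> hit P pi i x.
Proof.
set M := hit_max P pi i.
have lo : (hit P pi i x - M ^+ 2 * harmonic k) @[k --> \oo] --> hit P pi i x.
  rewrite -[X in _ --> X]subr0 -[X in _ --> _ - X](mulr0 (M ^+ 2)).
  by apply: cvgB; [exact: cvg_cst|apply: cvgMl_tmp; exact: cvg_harmonic].
apply: squeeze_cvgr lo (cvg_cst _); near=> k; rewrite big_mkord.
rewrite sum_surv_le // andbT lerBlDr -lerBlDl.
apply: le_trans (hit_tail i stochP irrP statP _ _) _.
rewrite expr2 -mulrA ler_wpM2l //.
  by apply: le_trans ler01 _; exact: (hit_max_ge1 i stochP irrP statP).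
rewrite /= ler_pdivlMr ?ltr0n // mulrC.
apply: le_trans (surv_markov i stochP irrP statP _ _) _; exact: hit_le_max.
Unshelve. all: end_near. Qed.

Context (d : measure_display) (Om : measurableType d)
  (PP : 'I_n -> probability Om R) (X : nat -> Om -> 'I_n).
Hypothesis mfX : markov_family PP P X.

Lemma mean_return_timeE x : mean_return_time PP X x i = (hit P pi i x)%:E.
Proof.
rewrite /mean_return_time.
under eq_integral do rewrite return_time_series.
have E t : (fun w => ((avoids i (X^~ w) t)%:R : R)%:E) =
    (fun w => (\1_(no_return X i t) w)%:E).
  by apply/funext => w; rewrite indicE.
rewrite integral_nneseries //; last first.
  move=> t; have := E t => ->; apply/measurable_EFinP.
  exact/measurable_indic/(measurable_no_return (mfX x)).
rewrite (@eq_eseriesr _ _ (fun t => (surv P i t x)%:E)); last first.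
  move=> t _; rewrite E integral_indic //;
    last exact: (measurable_no_return (mfX x)).
  rewrite setIT -(prob_no_return (mfX x)); apply: probE.
  exact: (measurable_no_return (mfX x)).
apply: cvg_lim => //.
rewrite (_ : (fun k => _) = (fun k => (\sum_(0 <= t < k) surv P i t x)%:E)).
  by apply: cvg_EFin; [near=> k|exact: cvg_sum_surv].
by apply/funext => k; rewrite sumEFin.
Unshelve. all: end_near. Qed.

Lemma H_maxE : H_max PP X i = hit_max P pi i.
Proof.
rewrite /H_max /hit_max.
suff -> : \big[maxe/0%E]_(x < n) mean_return_time PP X x i =
  (\big[Num.max/0]_(x < n) hit P pi i x)%:E by [].
elim/big_ind2 : _ => // [a b c e -> ->|x _]; first by rewrite EFin_max.
exact: mean_return_timeE.
Qed.

End MeanReturnTime.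

(** * Concentration of independent truncated samples *)

Section ExponentialBounds.
Context {R : realType}.
Implicit Types x y : R.

(** The quotient [f] has derivative of the sign of [y (1 - 2 y)], so it is minimal at 0 on the
    half-line up to 1/2. The coefficient 2/3 is what puts the other sign change exactly at 1/2. *)
Lemma expR_le_quadratic x : x <= 2^-1 -> expR x <= 1 + x + 2 / 3 * x ^+ 2.
Proof.
move=> x2.
pose f (y : R) : R := (1 + y + 2 / 3 * y ^+ 2) * expR (- y).
have df y : is_derive y 1 f (y / 3 * (1 - 2 * y) * expR (- y)).
  rewrite /f; apply: is_derive_eq; rewrite /GRing.scale /=; by field.
have cf a b : {within `[a, b], continuous f}.
  apply: continuous_subspaceT => z; apply: differentiable_continuous.
  by apply/derivable1_diffP; case: (df z).
suff : 1 <= f x.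
  by rewrite /f expRN -[X in X <=
    _](mulfV (lt0r_neq0 (expR_gt0 x))) ler_pM2r // invr_gt0 expR_gt0.
have f0 : f 0 = 1 by rewrite /f oppr0 expR0 expr0n /= mulr0 !addr0 mulr1.
case: (ltrgt0P x) => x0; last by rewrite x0 f0.
- have [c] := MVT x0 (fun y _ => df y) (cf 0 x).
  rewrite in_itv /= => /andP[c0 cx]; rewrite f0 subr0 => e.
  rewrite -subr_ge0 e; apply: mulr_ge0 (ltW x0); apply: mulr_ge0 (expR_ge0 _).
  by apply: mulr_ge0; lra.
- have [c] := MVT x0 (fun y _ => df y) (cf x 0).
  rewrite in_itv /= => /andP[c0 cx]; rewrite f0 sub0r => e.
  rewrite -subr_le0 e mulrN oppr_le0; apply: mulr_le0 (ltW x0).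
  by apply: mulr_le0_ge0 (expR_ge0 _); apply: mulr_le0_ge0; lra.
Qed.

Lemma expR1_le3 : expR 1 <= 3 :> R.
Proof.
have -> : (1 : R) = 2^-1 + 2^-1 by lra.
have h : expR 2^-1 <= 5 / 3 :> R.
  by apply: le_trans (expR_le_quadratic (lexx _)) _; lra.
rewrite expRD; apply: le_trans (ler_pM (expR_ge0 _) (expR_ge0 _) h h) _; lra.
Qed.

(* Convexity: the chord of the exponential over [0, x]. *)
Lemma expR_secant x (v th : nat) : (0 < th)%N -> (v <= th)%N ->
  expR (x / th%:R) ^+ v <= 1 + v%:R / th%:R * (expR x - 1).
Proof.
move=> th0 vth; have th0' : (0 : R) < th%:R by rewrite ltr0n.
have t0 : (0 : R) <= v%:R / th%:R by rewrite divr_ge0.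
have t1 : v%:R / th%:R <= 1 :> R by rewrite ler_pdivrMr // mul1r ler_nat.
have := convex_expR (Itv01 t0 t1) x 0.
rewrite !convRE /= /unstable.onem expR0 !mulr0 !addr0 => h.
rewrite -expRM_natl (_ : v%:R * (x / th%:R) = v%:R / th%:R * x);
  last by rewrite mulrCA mulrC.
by apply: le_trans h _; lra.
Qed.

End ExponentialBounds.

(** * Chernoff bounds for fresh trajectories given the past *)

Section Independence.
Context (R : realType) (d : measure_display) (Om : measurableType d)
  (Pr : probability Om R) (I : choiceType) (n : nat)
  (Y : I -> nat -> Om -> 'I_n).
Hypotheses (mY : forall j t x, measurable (Y j t @^-1` [set x]))
  (indY : independent_processes Pr Y).

Lemma sigma_process_measurable j A : sigma_process (Y j) A -> measurable A.
Proof.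
apply: smallest_sub; first exact: sigma_algebra_measurable.
by move=> _ [t [x ->]].
Qed.

(* The past of the algorithm has this property with respect to the trajectories
   already used; it replaces conditioning on that past. *)
Definition indep_of (K : pred I) (A : set Om) : Prop :=
  measurable A /\ forall (J : seq I) (B : I -> set Om), uniq J ->
    (forall j, j \in J -> ~~ K j /\ sigma_process (Y j) (B j)) ->
    prob Pr (A `&` \bigcap_(j in [set` J]) B j) =
    prob Pr A * \prod_(j <- J) prob Pr (B j).

Let measurable_family (J : seq I) (B : I -> set Om) :
  (forall j, j \in J -> sigma_process (Y j) (B j)) ->
  measurable (\bigcap_(j in [set` J]) B j).
Proof.
move=> JB; apply: fin_bigcap_measurable => // j /= jJ.
exact: sigma_process_measurable (JB _ jJ).
Qed.

Lemma indep_of_setT : indep_of pred0 setT.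
Proof.
split=> // J B uJ JB; rewrite setTI prob_setT mul1r.
have sB j : j \in J -> sigma_process (Y j) (B j) by move=> /JB[].
apply: EFin_inj; rewrite -probE; last exact: measurable_family.
rewrite (indY uJ sB) -prodEFin big_seq [RHS]big_seq; apply: eq_bigr => j jJ.
by rewrite probE //; apply: sigma_process_measurable (sB _ jJ).
Qed.

Lemma indep_of_set0 K : indep_of K set0.
Proof. by split=> // J B _ _; rewrite set0I prob_set0 mul0r. Qed.

Lemma indep_of_sub (K K' : pred I) A : (forall j, K j -> K' j) -> indep_of K A
  ->
  indep_of K' A.
Proof.
move=> KK' [mA H]; split=> // J B uJ JB; apply: H => // j /JB[nK sB].
by split => //; apply: contra nK; exact: KK'.
Qed.

Lemma indep_of_prob K A j B : indep_of K A -> ~~ K j -> sigma_process (Y j) B ->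
  prob Pr (A `&` B) = prob Pr A * prob Pr B.
Proof.
move=> [_ H] nK sB; have := H [:: j] (fun=> B) isT; rewrite big_seq1 => <-.
  congr (prob Pr (_ `&` _)); apply/seteqP; split => [w Bw k|w]; first by [].
  by apply; rewrite /= inE.
by move=> k; rewrite inE => /eqP ->.
Qed.

(** Looking at trajectory [j] keeps independence from the others and marks [j] as spent. The proof
    applies the hypothesis to the list extended by [j]. *)
Lemma indep_of_cap K A j B : indep_of K A -> ~~ K j -> sigma_process (Y j) B ->
  indep_of (fun l => K l || (l == j)) (A `&` B).
Proof.
move=> AK nK sB; split.
  by apply: measurableI; [case: AK|exact: sigma_process_measurable sB].
move=> J C uJ JC; rewrite (indep_of_prob AK nK sB).
have jJ : j \notin J by apply/negP => /JC[]; rewrite eqxx orbT.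
pose D l := if l == j then B else C l.
have DC l : l \in J -> D l = C l.
  by rewrite /D; case: eqVneq => // ->; rewrite (negbTE jJ).
case: AK => _ /(_ (j :: J) D); rewrite cons_uniq jJ uJ => /(_ isT).
have -> : A `&` \bigcap_(l in [set` j :: J]) D l =
    A `&` B `&` \bigcap_(l in [set` J]) C l.
  rewrite -setIA; congr (_ `&` _); apply/seteqP; split => [w Dw|w [Bw Cw] l].
    split; first by have := Dw j; rewrite /D /= eqxx inE eqxx; apply.
    by move=> l /= lJ; rewrite -DC //; apply: Dw; rewrite /= inE lJ orbT.
  by rewrite /= inE => /orP[/eqP ->|lJ]; [rewrite /D eqxx|rewrite DC //;
    exact: Cw].
move=> ->; last first.
  move=> l; rewrite inE => /orP[/eqP ->|lJ]; first by rewrite /D eqxx.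
  by rewrite DC //; have [] := JC _ lJ; rewrite negb_or => /andP[].
rewrite big_cons {1}/D eqxx mulrA; congr (_ * _).
by rewrite big_seq [RHS]big_seq; apply: eq_bigr => l lJ; rewrite DC.
Qed.

(** Both sides of the product formula are countably additive in the event, so independence may be
    checked on the fibres of a countable-valued function. *)
Lemma indep_of_partition (T : countType) (f : Om -> T) K A :
  (forall v, indep_of K (A `&` f @^-1` [set v])) -> indep_of K A.
Proof.
move=> Kf; have mAf v : measurable (A `&` f @^-1` [set v]) by case: (Kf v).
have KF k : indep_of K (A `&` [set w | pickle (f w) = k]).
  by case: (pickle_fibre f k) => [[v ->]|->] //; rewrite setI0;
    exact: indep_of_set0.
have mA := measurable_partition mAf.
split=> // J B uJ JB; set C := \bigcap_(j in _) _; set c := \prod_(j <- J) _.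
have mC : measurable C by apply: measurable_family => j /JB[].
have c0 : 0 <= c by apply: prodr_ge0 => j _; exact: prob_ge0.
have mACf v : measurable (A `&` C `&` f @^-1` [set v]).
  by rewrite setIAC; exact: measurableI.
apply: EFin_inj; rewrite mulrC EFinM -!probE //; last exact: measurableI.
rewrite (prob_series_partition Pr mACf) (prob_series_partition Pr mAf).
rewrite -nneseriesZl; last by move=> k _; rewrite lee_fin prob_ge0.
apply: eq_eseriesr => k _; rewrite -EFinM setIAC mulrC.
by case: (KF k) => _ /(_ J B uJ JB) ->.
Qed.

Section PartialSums.
Context (L : I -> Om -> nat) (idx : nat -> I) (th : nat) (p : nat -> R)
  (K : pred I) (A : set Om).
Hypotheses (sL : forall s v, sigma_process (Y (idx s)) (L (idx s) @^-1` [set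
  v]))
  (idx_inj : injective idx) (Kidx : forall s, ~~ K (idx s))
  (KA : indep_of K A).

Definition partial_sum m w : nat := (\sum_(s < m) L (idx s) w)%N.

Let KS m l := K l || (l \in map idx (iota 0 m)).

Let fresh m : ~~ KS m (idx m).
Proof.
rewrite /KS negb_or Kidx; apply/mapP => -[s];
  rewrite mem_iota => /= sm /idx_inj ms.
by rewrite -ms add0n ltnn in sm.
Qed.

Let partial_sumS m a v :
  A `&` [set w | partial_sum m.+1 w = a] `&` L (idx m) @^-1` [set v] =
  if (v <= a)%N then A `&` [set w | partial_sum m w = (a - v)%N] `&`
                     L (idx m) @^-1` [set v]
  else set0.
Proof.
have E w : partial_sum m.+1 w = (partial_sum m w + L (idx m) w)%N.
  by rewrite /partial_sum big_ord_recr.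
case: ifPn => va; apply/seteqP; split => // w /=.
- by move=> [[Aw + Lv]]; rewrite E Lv => Wa; split => //; split => //; lia.
- by move=> [[Aw + Lv]]; rewrite E Lv => Wa; split => //; split => //; lia.
- by move=> [[_ + Lv]]; rewrite E Lv; lia.
Qed.

(** Once the last length is fixed, the event is one for a shorter sum, cut with an event of a fresh
    trajectory. *)
Lemma indep_of_partial_sum m a :
  indep_of (KS m) (A `&` [set w | partial_sum m w = a]).
Proof.
elim: m a => [|m IH] a.
  case: (eqVneq a 0%N) => [->|a0].
    rewrite (_ : _ `&` _ = A); last first.
      apply/seteqP; split => [w []//|w Aw]; split => //=.
      by rewrite /partial_sum big_ord0.
    by apply: indep_of_sub KA => l; rewrite /KS => ->.
  rewrite (_ : _ `&` _ = set0); first exact: indep_of_set0.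
  apply/seteqP; split => // w [_ /=]; rewrite /partial_sum big_ord0 => a0'.
  by rewrite -a0' eqxx in a0.
apply: (@indep_of_partition _ (L (idx m))) => v; rewrite partial_sumS.
case: ifPn => _; last exact: indep_of_set0.
apply: (indep_of_sub _ (indep_of_cap (IH _) (fresh _) (@sL m v))) => l.
by rewrite /KS -orbA -addn1 iotaD map_cat mem_cat /= add0n inE.
Qed.

Hypotheses (Lth : forall s w, (L (idx s) w <= th)%N)
  (pL : forall s v, (v <= th)%N -> prob Pr (L (idx s) @^-1` [set v]) = p v).

(* The powers of this polynomial carry the laws of the partial sums, so that the
   exponential Markov inequality is an evaluation at a point. *)
Definition gen_poly : {poly R} := \poly_(v < th.+1) p v.

Let mL s v : measurable (L (idx s) @^-1` [set v]).
Proof. exact: sigma_process_measurable (@sL s v). Qed.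

(** Summing over the length of the last trajectory is a convolution, that is, multiplication by one
    more factor [gen_poly]. *)
Lemma prob_partial_sum m a :
  prob Pr (A `&` [set w | partial_sum m w = a]) = prob Pr A * (gen_poly ^+
    m)`_a.
Proof.
elim: m a => [|m IH] a.
  rewrite expr0 coef1; case: eqVneq => [->|a0].
    rewrite mulr1; congr prob; apply/seteqP; split => [w []//|w Aw].
    by split => //=; rewrite /partial_sum big_ord0.
  rewrite mulr0 -(prob_set0 Pr); congr prob; apply/seteqP; split => // w [_ /=].
  by rewrite /partial_sum big_ord0 => a0'; rewrite -a0' eqxx in a0.
have [mA _] := indep_of_partial_sum m.+1 a.
pose f w : 'I_th.+1 := inord (L (idx m) w).
have fE (v : 'I_th.+1) : f @^-1` [set v] = L (idx m) @^-1` [set val v].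
  apply/seteqP; split => w /= => [<-|fw]; first by rewrite inordK // ltnS.
  by rewrite /f fw inord_val.
rewrite (@prob_partition _ _ _ Pr _ f) //; last by move=> v; rewrite fE.
rewrite exprSr /gen_poly poly_def mulr_sumr coef_sum mulr_sumr.
apply: eq_bigr => v _; rewrite fE partial_sumS -scalerAr coefZ coefMXn ltnNge.
case: ifPn => va /=; last by rewrite prob_set0 !mulr0.
rewrite (indep_of_prob (indep_of_partial_sum m _) (fresh _) (@sL m v)).
rewrite IH pL; last by rewrite -ltnS.
by rewrite /gen_poly poly_def -mulrA [p _ * _]mulrC.
Qed.

Lemma partial_sum_le m w : (partial_sum m w <= m * th)%N.
Proof.
rewrite /partial_sum -[X in (_ <= X * _)%N](card_ord m) -sum_nat_const.
by apply: leq_sum => s _.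
Qed.

(** Coefficients of [gen_poly ^+ m] are weighted by [y ^+ v]: those with [S v] contribute at least
    [c] times their probability, the others are nonnegative. Both tails fit, with [y] above or below
    1. *)
Lemma partial_sum_markov m (S : pred nat) c y : 0 <= y ->
  (forall v, S v -> c <= y ^+ v) ->
  c * prob Pr (A `&` [set w | S (partial_sum m w)]) <=
    prob Pr A * gen_poly.[y] ^+ m.
Proof.
move=> y0 Sc; pose f w : 'I_(m * th).+1 := inord (partial_sum m w).
have mW v : measurable (A `&` [set w | partial_sum m w = v]).
  by case: (indep_of_partial_sum m v).
have fE (v : 'I_(m * th).+1) : f @^-1` [set v] = [set w | partial_sum m w = val
  v].
  apply/seteqP; split => w /= => [<-|fw];
    first by rewrite inordK // ltnS partial_sum_le.
  by rewrite /f fw inord_val.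
have SE (v : 'I_(m * th).+1) : (A `&` [set w | S (partial_sum m w)]) `&` f
  @^-1` [set v] =
    if S v then A `&` [set w | partial_sum m w = val v] else set0.
  rewrite fE; case: ifPn => Sv; apply/seteqP; split => // w /=.
  - by move=> [[]].
  - by move=> [Aw Ww]; rewrite Ww.
  - by move=> [[_]] + Ww; rewrite Ww (negbTE Sv).
rewrite (@prob_partition_cap _ _ _ Pr _ f); last first.
  by move=> v; rewrite SE; case: ifP.
rewrite -horner_exp (@horner_coef_wide _ (m * th).+1); last first.
  apply: leq_trans (size_poly_exp_leq _ _) _; rewrite ltnS mulnC leq_mul2l.
  apply/orP; right; have : (size gen_poly <= th.+1)%N := size_poly _ _.
  by case: (size _).
rewrite !mulr_sumr; apply: ler_sum => v _; rewrite SE.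
rewrite mulrA -prob_partial_sum; case: ifPn => Sv.
  by rewrite mulrC ler_wpM2l ?prob_ge0 // Sc.
by rewrite prob_set0 mulr0 mulr_ge0 ?prob_ge0 ?exprn_ge0.
Qed.

Lemma indep_of_partial_sum_in m (S : pred nat) :
  indep_of (KS m) (A `&` [set w | S (partial_sum m w)]).
Proof.
apply: (@indep_of_partition _ (partial_sum m)) => v.
case: (boolP (S v)) => Sv.
  rewrite (_ : _ `&` _ `&` _ = A `&` [set w | partial_sum m w = v]).
    exact: indep_of_partial_sum.
  by apply/seteqP; split => w /= => [[[]]|[Aw Ww]] //; rewrite Ww.
rewrite (_ : _ `&` _ `&` _ = set0); first exact: indep_of_set0.
by apply/seteqP; split => // w /= [[_]] + Ww; rewrite Ww (negbTE Sv).
Qed.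

Definition pmf_mean : R := \sum_(v < th.+1) p v * v%:R.

Hypotheses (th0 : (0 < th)%N) (p0 : forall v, 0 <= p v)
  (p1 : \sum_(v < th.+1) p v = 1).

(** After rescaling lengths to [0, 1], the secant bound is affine in the length, so the law enters
    through its mean alone. *)
Lemma gen_poly_expR_le x : x <= 2^-1 ->
  gen_poly.[expR (x / th%:R)] <=
  expR (pmf_mean / th%:R * (x + 2 / 3 * x ^+ 2)).
Proof.
move=> x2; rewrite horner_poly.
apply: le_trans (_ : \sum_(v < th.+1) p v * (1 + v%:R / th%:R * (expR x - 1))
  <= _).
  by apply: ler_sum => v _; rewrite ler_wpM2l // expR_secant // -ltnS.
have -> : \sum_(v < th.+1) p v * (1 + v%:R / th%:R * (expR x - 1)) =
    1 + pmf_mean / th%:R * (expR x - 1).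
  under eq_bigr do rewrite mulrDr mulr1 !mulrA.
  by rewrite big_split /= p1 -!mulr_suml.
apply: le_trans (expR_ge1Dx _); rewrite lerD2l; apply: ler_wpM2l.
  by rewrite divr_ge0 // sumr_ge0 // => v _; rewrite mulr_ge0.
by have := expR_le_quadratic x2; lra.
Qed.

(** The sign of [x] selects the tail: the condition on [S] reads [a <= v] for [x > 0] and [v <= a]
    for [x < 0]. *)
Lemma partial_sum_tail m (S : pred nat) x a : x <= 2^-1 ->
  (forall v : nat, S v -> x * a <= x * v%:R) ->
  prob Pr (A `&` [set w | S (partial_sum m w)]) <=
  prob Pr A * expR ((m%:R * pmf_mean * (x + 2 / 3 * x ^+ 2) - x * a) / th%:R).
Proof.
move=> x2 Sa.
have := @partial_sum_markov m S (expR (x * a / th%:R)) (expR (x / th%:R))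
  (expR_ge0 _).
have c v : S v -> expR (x * a / th%:R) <= expR (x / th%:R) ^+ v.
  move=> /Sa h; rewrite -expRM_natr ler_expR [leRHS]mulrAC.
  by rewrite ler_wpM2r // invr_ge0.
move=> /(_ c) h; rewrite mulrBl expRB mulrA ler_pdivlMr ?expR_gt0 // mulrC.
apply: le_trans h _; apply: ler_wpM2l; first exact: prob_ge0.
rewrite (_ : m%:R * pmf_mean * _ / th%:R = m%:R * (pmf_mean / th%:R * (x + 2 /
  3 * x ^+ 2))); last by ring.
rewrite expRM_natl; apply: lerXn2r; rewrite ?nnegrE ?expR_ge0 //.
  by rewrite horner_poly sumr_ge0 // => v _;
    rewrite mulr_ge0 // exprn_ge0 // expR_ge0.
exact: gen_poly_expR_le.
Qed.

Definition off_mean e (m v : nat) : bool :=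
  (v%:R <= (1 - e) * (m%:R * pmf_mean)) || ((1 + e) * (m%:R * pmf_mean) <=
    v%:R).

(** With tilt [x = e] for the upper tail and [x = - e] for the lower one, the threshold is [1 + x]
    times the mean, and [x + 2/3 x^2 - x (1 + x) = - e^2 / 3] in both cases. This is the 3 in the
    sample sizes. *)
Lemma partial_sum_deviation m (e : R) : 0 <= e <= 2^-1 ->
  prob Pr (A `&` [set w | off_mean e m (partial_sum m w)]) <=
  prob Pr A * (2 * expR (- (m%:R * pmf_mean * e ^+ 2 / (3 * th%:R)))).
Proof.
case/andP=> e0 e2.
pose Sl (v : nat) := v%:R <= (1 - e) * (m%:R * pmf_mean).
pose Su (v : nat) := (1 + e) * (m%:R * pmf_mean) <= v%:R.
have mS (S : pred nat) : measurable (A `&` [set w | S (partial_sum m w)]).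
  by case: (indep_of_partial_sum_in m S).
have -> : A `&` [set w | off_mean e m (partial_sum m w)] =
    (A `&` [set w | Sl (partial_sum m w)]) `|` (A `&` [set w | Su (partial_sum
      m w)]).
  rewrite -setIUr; congr (_ `&` _); apply/seteqP; split => w /=.
    by move=> /orP.
  by move=> h; apply/orP.
apply: le_trans (prob_setU2 _ (mS _) (mS _)) _.
have th0' : (th%:R : R) != 0 by rewrite pnatr_eq0 -lt0n.
rewrite [2 * _](_ : _ = expR (- (m%:R * pmf_mean * e ^+ 2 / (3 * th%:R))) +
  expR (- (m%:R * pmf_mean * e ^+ 2 / (3 * th%:R)))); last by ring.
rewrite mulrDr; apply: lerD.
  have := @partial_sum_tail m Sl (- e) ((1 - e) * (m%:R * pmf_mean)).
  rewrite [X in _ * expR X](_ : _ = - (m%:R * pmf_mean * e ^+ 2 / (3 * th%:R))).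
    by apply; [lra|move=> v; rewrite /Sl !mulNr lerN2; exact: ler_wpM2l].
  by field.
have := @partial_sum_tail m Su e ((1 + e) * (m%:R * pmf_mean)).
rewrite [X in _ * expR X](_ : _ = - (m%:R * pmf_mean * e ^+ 2 / (3 * th%:R))).
  by apply; [lra|move=> v; rewrite /Su; exact: ler_wpM2l].
by field.
Qed.

End PartialSums.
End Independence.

(** * Iterated refinement *)

Section StopLength.
Context (R : realType) (n : nat) (i : 'I_n) (d : measure_display)
  (Om : measurableType d).

Section OneProcess.
Variable X : nat -> Om -> 'I_n.

Let G := [set A | exists t x, A = X t @^-1` [set x]].

Let measurable_state t (b : pred 'I_n) :
  (measurable : set_system (g_sigma_algebraType G)) [set w | b (X t w)].
Proof.
rewrite (_ : [set w | _] = \bigcup_(x in [set x | b x]) X t @^-1` [set x]).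
  apply: fin_bigcup_measurable; first exact: finite_finset.
  by move=> x _; apply: sub_sigma_algebra; exists t, x.
apply/seteqP; split => [w /= bw|w [x /= bx wx]]; first by exists (X t w).
by rewrite wx.
Qed.

Let measurable_stop_gt th t : (0 < th)%N ->
  (measurable : set_system (g_sigma_algebraType G))
    [set w | (t < stop_length i th (X^~ w))%N].
Proof.
move=> th0; case: (ltnP t th) => tth; last first.
  rewrite (_ : [set w | _] = set0); first exact: measurable0.
  by apply/seteqP; split => // w /=; rewrite stop_length_gt // ltnNge tth.
rewrite (_ : [set w | _] = \bigcap_(u in [set u | (0 < u <=
  t)%N]) [set w | predC1 i (X u w)]).
  by apply: bigcap_measurableType => u _; exact: measurable_state.
apply/seteqP; split => w /=; rewrite stop_length_gt // tth /=.
  by move=> /avoidsP.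
by move=> h; apply/avoidsP.
Qed.

Lemma sigma_process_stop_length th v : (0 < th)%N ->
  sigma_process X ((fun w => stop_length i th (X^~ w)) @^-1` [set v]).
Proof.
move=> th0; set L := fun w => _.
rewrite (_ : L @^-1` [set v] =
  (if v is v'.+1 then [set w | (v' < L w)%N] else setT) `\` [set w | (v < L
    w)%N]).
  apply: (@measurableD _ (g_sigma_algebraType G));
    last exact: measurable_stop_gt.
  by case: v => [|v]; [exact: measurableT|exact: measurable_stop_gt].
apply/seteqP; split => w /=.
  by move=> Lw; split; [case: (v) Lw => //= u ->|rewrite Lw ltnn].
by case: v => [|v] [] /=; move: (L w) => l; rewrite ?ltnS; lia.
Qed.

End OneProcess.

Context (Pr : probability Om R) (P : 'M[R]_n) (X : nat -> Om -> 'I_n).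
Hypothesis mcX : markov_chain Pr P i X.

Definition stop_tail th t : R := if (t < th)%N then surv P i t i else 0.

(** A point mass as a difference of consecutive tails; the tail preceding 0 is 1. *)
Definition stop_pmf th v : R :=
  (if v is v'.+1 then stop_tail th v' else 1) - stop_tail th v.

Lemma prob_stop_length th v : (0 < th)%N ->
  prob Pr ((fun w => stop_length i th (X^~ w)) @^-1` [set v]) = stop_pmf th v.
Proof.
move=> th0; set L := fun w => _.
have LE t : [set w | (t < L w)%N] = if (t < th)%N then no_return X i t else
  set0.
  case: ifPn => tth; apply/seteqP; split => w //=;
    rewrite stop_length_gt // ?tth ?(negbTE tth) //=.
    by move=> /avoidsP.
  by move=> h; apply/avoidsP.
have mL t : measurable [set w | (t < L w)%N].
  by rewrite LE; case: ifP => // _; exact: (measurable_no_return mcX).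
have pL t : prob Pr [set w | (t < L w)%N] = stop_tail th t.
  by rewrite LE /stop_tail; case: ifP => _;
    rewrite ?prob_set0 // (prob_no_return mcX).
set U := if v is v'.+1 then [set w | (v' < L w)%N] else setT.
have mU : measurable U by rewrite /U; case: (v).
have -> : L @^-1` [set v] = U `\` [set w | (v < L w)%N].
  rewrite /U; apply/seteqP; split => w /=.
    by move=> Lw; split; [case: (v) Lw => //= u ->|rewrite Lw ltnn].
  by case: v {U mU} => [|v] [] /=; move: (L w) => l; lia.
have UI : U `&` [set w | (v < L w)%N] = [set w | (v < L w)%N].
  apply/seteqP; split => w /= => [[]//|vL]; split=> //.
  by rewrite /U; case: v {U mU} vL => //= v; move: (L w) => l; lia.
apply: EFin_inj; rewrite -probE; last exact: measurableD.
have -> : Pr (U `\` [set w | (v < L w)%N]) =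
    (Pr U - Pr (U `&` [set w | (v < L w)%N]))%E.
  by apply: measureD => //;
    rewrite [X in (X < _)%E](_ : _ = Pr U) // probE // ltry.
rewrite UI !probE // pL -EFinB; congr (_ - _)%:E.
by rewrite /U; case: v {U mU UI} => [|v]; rewrite ?prob_setT ?pL.
Qed.

Lemma stop_tail_end th : stop_tail th th = 0.
Proof. by rewrite /stop_tail ltnn. Qed.

Lemma sum_stop_pmf th : \sum_(v < th.+1) stop_pmf th v = 1.
Proof.
have h N : \sum_(v < N.+1) stop_pmf th v = 1 - stop_tail th N.
  elim: N => [|N IH]; first by rewrite big_ord1.
  by rewrite big_ord_recr /= IH /stop_pmf addrA subrK.
by rewrite h stop_tail_end subr0.
Qed.

(** Summation by parts; the boundary term disappears because the tail at [th] is 0. *)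
Lemma mean_stop_pmf th : pmf_mean th (stop_pmf th) = \sum_(t < th) surv P i t i.
Proof.
rewrite /pmf_mean.
have h N : \sum_(v < N.+1) stop_pmf th v * v%:R =
    \sum_(t < N) stop_tail th t - N%:R * stop_tail th N.
  elim: N => [|N IH]; first by rewrite big_ord1 big_ord0 mulr0 mul0r subr0.
  rewrite big_ord_recr IH [in RHS]big_ord_recr /= /stop_pmf -[N.+1]addn1 natrD.
  ring.
rewrite h stop_tail_end mulr0 subr0; apply: eq_bigr => t _.
by rewrite /stop_tail ltn_ord.
Qed.

End StopLength.

Section IteratedRefinement.
Context (R : realType) (n : nat) (P : 'M[R]_n) (pi : 'rV[R]_n) (i : 'I_n)
  (d : measure_display) (Om : measurableType d) (Pr : probability Om R)
  (Y : nat * nat -> nat -> Om -> 'I_n) (e alpha : R).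
Hypotheses (stochP : stochastic P) (irrP : irreducible P)
  (statP : stationary P pi)
  (mcY : forall ks, markov_chain Pr P i (Y ks))
  (indY : independent_processes Pr Y).
Hypotheses (e0 : 0 < e) (e2 : e <=
  2^-1) (alpha0 : 0 < alpha) (alpha1 : alpha < 1).

Definition trunc_mean k : R := \sum_(t < theta k) surv P i t i.
Local Notation mu := trunc_mean.

Lemma theta_gt0 k : (0 < theta k)%N.
Proof. by rewrite expn_gt0. Qed.

Lemma theta_ge1 k : 1 <= (theta k)%:R :> R.
Proof. by rewrite ler1n theta_gt0. Qed.

Lemma thetaS k : (theta k.+1)%:R = 2 * (theta k)%:R :> R.
Proof. by rewrite /theta expnS natrM. Qed.

Lemma trunc_mean_ge1 k : 1 <= mu k.
Proof.
rewrite /mu -(prednK (theta_gt0 k)) big_ord_recl surv0 lerDl.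
by apply: sumr_ge0 => t _; exact: surv_ge0.
Qed.

Lemma trunc_mean_le k : pi 0 i * mu k <= 1.
Proof.
have pi0 := stationary_gt0 i stochP irrP statP.
rewrite mulrC -ler_pdivlMr // div1r.
by have := sum_surv_le i stochP irrP statP (theta k) i; rewrite /hit eqxx.
Qed.

(** The second half of the doubled range has smaller survival probabilities. Monotonicity keeps the
    previous estimate usable in the next sample size; the factor 2 keeps that size from being
    wasteful. *)
Lemma trunc_meanS k : mu k <= mu k.+1 <= 2 * mu k.
Proof.
have -> : mu k.+1 = mu k + \sum_(t < theta k) surv P i (theta k + t) i.
  have -> : mu k.+1 = \sum_(t < theta k + theta k) surv P i t i.
    by rewrite /mu /theta expnS mul2n -addnn.
  by rewrite big_split_ord.
rewrite lerDl mulr_natl mulr2n lerD2l; apply/andP; split.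
  by apply: sumr_ge0 => t _; exact: surv_ge0.
by apply: ler_sum => t _; apply: surv_le => //; exact: leq_addl.
Qed.

Let len (ks : nat * nat) w := stop_length i (theta ks.1) (fun t => Y ks t w).
Let That k w := T_hat i e alpha (fun k s t => Y (k, s) t w) k.
Let N (k : nat) w := if k is k'.+1 then sample_size e alpha k (That k' w) else
  0%N.
Let W (k : nat) w := partial_sum len (pair k) (N k w) w.

Let That_E k w : That k w = (W k w)%:R / (N k w)%:R.
Proof.
case: k => [|k]; first by rewrite /W /partial_sum /= big_ord0 mul0r.
by rewrite /W /partial_sum natr_sum mulrC.
Qed.

Lemma ln_theta_ge1 k : 1 <= ln (4 * (theta k.+1)%:R / alpha).
Proof.
apply: le_trans (_ : ln 3 <= _).
  rewrite -[X in X <= _](@expRK R) ler_ln ?posrE ?expR_gt0 //.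
  exact: expR1_le3.
have q (t : R) : 1 <= t -> 3 <= 4 * t / alpha by move: (alpha1) => a1 t1;
  rewrite ler_pdivlMr //; lra.
have := q _ (theta_ge1 k.+1) => {}q.
by rewrite ler_ln ?posrE // (lt_le_trans _ q).
Qed.

(** The quantity rounded up in iteration [k + 1]; the index is shifted so that 0 is the first
    iteration. *)
Let sample_arg k (T : R) : R :=
  if k is 0%N then 6 * (1 + e) * ln (8 / alpha) / e ^+ 2
  else 3 * (1 + e) * (theta k.+1)%:R * ln (4 * (theta k.+1)%:R / alpha) / (T *
    e ^+ 2).

Let ln8 : ln (8 / alpha) = ln (4 * (theta 1)%:R / alpha).
Proof. by congr (ln (_ / _)); rewrite /theta expn1 -natrM. Qed.

Let sample_arg_gt0 k (T : R) : (k = 0%N) \/ 0 < T -> 0 < sample_arg k T.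
Proof.
have e1 : 0 < 1 + e by rewrite addr_gt0.
have ee : 0 < e ^+ 2 by rewrite exprn_gt0.
case: k => [_|k [//|T0]] /=.
  rewrite ln8; have := ln_theta_ge1 0 => l1.
  by rewrite divr_gt0 // !mulr_gt0 // (lt_le_trans _ l1).
have := ln_theta_ge1 k.+1 => l1; have t1 := theta_ge1 k.+2.
by rewrite divr_gt0 ?mulr_gt0 // ?(lt_le_trans _ l1) // (lt_le_trans _ t1).
Qed.

Let sample_sizeE k (T : R) : sample_size e alpha k.+1 T = `|Num.ceil
  (sample_arg k T)|%N.
Proof. by rewrite /sample_size; case: k. Qed.

Let sample_size_bounds k (T : R) : (k = 0%N) \/ 0 < T ->
  sample_arg k T <= (sample_size e alpha k.+1 T)%:R <= sample_arg k T + 1.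
Proof.
move=> /sample_arg_gt0; rewrite sample_sizeE; move: (sample_arg k T) => a a0.
have c0 : 0 <= Num.ceil a by rewrite ceil_ge0 (lt_trans _ a0).
rewrite -[(`|_|%N)%:R]/((Posz `|Num.ceil a|%N)%:~R) gez0_abs // ceil_ge /=.
by have := gt_pred_ceil a; rewrite intrB ltrBlDr => /ltW.
Qed.

Let run_bounds k w : (0 < N k.+1 w)%N /\ 1 <= That k.+1 w <= (theta k.+1)%:R.
Proof.
have step k' : (k' = 0%N) \/ 0 < That k' w ->
    (0 < N k'.+1 w)%N /\ 1 <= That k'.+1 w <= (theta k'.+1)%:R.
  move=> kT; have N0 : (0 < N k'.+1 w)%N.
    rewrite -(ltr0n R) (lt_le_trans (sample_arg_gt0 kT)) //.
    by case/andP: (sample_size_bounds kT).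
  split=> //; rewrite That_E ler_pdivlMr ?ltr0n // mul1r ler_nat.
  rewrite ler_pdivrMr ?ltr0n // mulrC -natrM ler_nat; apply/andP; split.
    rewrite /W /partial_sum -[X in (X <= _)%N](card_ord (N k'.+1 w)) -sum1_card.
    exact: leq_sum.
  rewrite /W /partial_sum -[X in (_ <=
    X * _)%N](card_ord (N k'.+1 w)) -sum_nat_const.
  by apply: leq_sum => s _; rewrite /len stop_length_le // theta_gt0.
elim: k => [|k [_ /andP[T1 _]]]; first by apply: step; left.
by apply: step; right; rewrite (lt_le_trans _ T1).
Qed.

(** It is enough that the exponent reach [ln (4 theta / alpha)], since twice [alpha / (4 theta)] is
    the claimed bound. In later iterations the surplus factor is [(1 + e) mu_{k+1} / r], at least
    [mu_{k+1} / mu_k >= 1]; in the first, [6 = 3 * theta 1] and [mu_1 >= 1] do the same. *)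
Let sample_size_suffices k r : (k = 0%N) \/ 0 < r -> r <= (1 + e) * mu k ->
  2 * expR (- ((sample_size e alpha k.+1 r)%:R * mu k.+1 * e ^+ 2 / (3 * (theta
    k.+1)%:R)))
  <= alpha / (2 ^ k.+2)%:R.
Proof.
move=> kr rmu; have /andP[mge _] := sample_size_bounds kr.
have t0 : 0 < (theta k.+1)%:R :> R by rewrite ltr0n theta_gt0.
have mu1 := trunc_mean_ge1 k.+1.
have ee : 0 < e ^+ 2 by rewrite exprn_gt0.
have l1 := ln_theta_ge1 k.
set l := ln (4 * (theta k.+1)%:R / alpha) in l1.
suff h : l <= (sample_size e alpha k.+1 r)%:R * mu k.+1 * e ^+ 2 / (3 * (theta
  k.+1)%:R).
  apply: le_trans (_ : 2 * expR (- l) <= _).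
    by rewrite ler_pM2l // ler_expR lerN2.
  rewrite expRN lnK ?posrE ?divr_gt0 ?mulr_gt0 // invf_div.
  rewrite expnS natrM -[(2 ^ k.+1)%N]/(theta k.+1) le_eqVlt; apply/orP; left;
    apply/eqP.
  by field; rewrite lt0r_neq0.
apply: le_trans (_ : sample_arg k r * mu k.+1 * e ^+ 2 / (3 * (theta k.+1)%:R)
  <= _); last first.
  apply: ler_wpM2r; first by rewrite invr_ge0 mulr_ge0 // ltW.
  apply: ler_wpM2r; first exact: ltW.
  by apply: ler_wpM2r mge; exact: le_trans ler01 mu1.
rewrite ler_pdivlMr ?mulr_gt0 //.
move: l1; rewrite /l; clear l => l1.
case: k kr rmu {mge} t0 mu1 l1 => [_ _ _ mu1 l1|k [//|r0] rmu t0 mu1 l1] /=.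
  rewrite ln8; set l := ln _ in l1 *.
  rewrite [X in _ <= X](_ : _ = l * (6 * (1 + e) * mu 1)); last first.
    by field; rewrite lt0r_neq0.
  rewrite ler_pM2l; last by rewrite (lt_le_trans _ l1).
  by move: (e0) => e0'; rewrite /theta expn1; nra.
set l := ln _ in l1 *.
rewrite [X in _ <= X](_ : _ = l * (3 * (theta k.+2)%:R) * ((1 + e) * mu k.+2 /
  r)); last first.
  by field; rewrite !lt0r_neq0.
have /andP[mm _] := trunc_meanS k.+1.
rewrite ler_peMr //; last by by move: (e0) => e0';
  rewrite ler_pdivlMr // mul1r; nra.
by rewrite mulr_ge0 ?mulr_ge0 ?(ltW t0) // (le_trans ler01).
Qed.

(** A countable summary of an iteration: it determines the estimate, hence the next sample size,
    which is constant on each fibre. *)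
Let state (k : nat) w := (N k w, W k w).

Let state_That k w v : state k w = v -> That k w = v.2%:R / v.1%:R.
Proof. by move=> <-; exact: That_E. Qed.

Let past k (ks : nat * nat) := (ks.1 <= k)%N.

Let mY ks t x : measurable (Y ks t @^-1` [set x]).
Proof. exact: (markov_chain_measurable (mcY ks)). Qed.

Let sL k s v : sigma_process (Y (k, s)) (len (k, s) @^-1` [set v]).
Proof. by apply: (@sigma_process_stop_length n i d Om (Y (k, s)) (theta k));
  exact: theta_gt0. Qed.

Let pair_inj k : injective (pair k : nat -> nat * nat).
Proof. by move=> s t []. Qed.

Let fresh k s : ~~ past k (k.+1, s).
Proof. by rewrite /past /= ltnn. Qed.

Let indep_of_state k v : indep_of Pr Y (past k) [set w | state k w = v].
Proof.
elim: k v => [|k IH] [M V].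
  have st w : state 0 w = (0%N, 0%N) by rewrite /state /W /partial_sum big_ord0.
  case: (eqVneq (M, V) (0%N, 0%N)) => [->|nz].
    rewrite (_ : [set w | _] = setT);
      first exact: (indep_of_sub _ (indep_of_setT mY indY)).
    by apply/seteqP; split => // w _; exact: st.
  rewrite (_ : [set w | _] = set0); first exact: indep_of_set0.
  by apply/seteqP; split => // w /= wv; rewrite -wv st eqxx in nz.
apply: (@indep_of_partition _ _ _ _ _ _ _ mY _ (state k)) => v.
(* Given the previous state, the sample size is forced: either it equals [M] and only the partial
   sum remains, or the event is empty. *)
case: (eqVneq (sample_size e alpha k.+1 (v.2%:R / v.1%:R)) M) => [mM|nM].
  rewrite (_ : _ `&` _ = [set w | state k w = v] `&`
      [set w | partial_sum len (pair k.+1) M w = V]).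
    apply: (indep_of_sub _ (indep_of_partial_sum mY (@sL k.+1) (@pair_inj k.+1)
      (fresh k) (IH v) M V)).
    move=> [k' s] /orP[h|/mapP[s' _ [-> _]]]; first exact: ltnW.
    by rewrite /past.
  apply/seteqP; split => w /=.
    by move=> [[NM WV] sv]; split => //; rewrite -WV /W [N k.+1 w]NM.
  move=> [sv WV]; split => //;
    have NM : N k.+1 w = M by rewrite /= (state_That sv).
  by rewrite /state /W NM WV.
rewrite (_ : _ `&` _ = set0); first exact: indep_of_set0.
apply/seteqP; split => // w /= [[NM _] sv].
by move: nM; rewrite -NM (state_That sv) eqxx.
Qed.

(* The bound on the previous estimate makes the sample size of iteration k+1
   large enough, so outside all these events every estimate is good. *)
Let bad (k : nat) := [set w | That k w <= (1 + e) * mu k /\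
  off_mean (theta k.+1) (stop_pmf i P (theta k.+1)) e (N k.+1 w) (W k.+1 w)].

Let bad_state k v :
  let m := sample_size e alpha k.+1 (v.2%:R / v.1%:R) in
  bad k `&` state k @^-1` [set v] =
  if v.2%:R / v.1%:R <= (1 + e) * mu k then
    [set w | state k w = v] `&`
    [set w | off_mean (theta k.+1) (stop_pmf i P (theta k.+1)) e m
      (partial_sum len (pair k.+1) m w)]
  else set0.
Proof.
move=> m; have NM w : state k w = v -> N k.+1 w = m.
  by move=> sv; rewrite /= (state_That sv).
case: ifPn => hv; apply/seteqP; split => // w /=.
- by move=> [[_ +] sv]; rewrite /W NM.
- by move=> [sv off]; split => //; split; rewrite ?(state_That sv) // /W NM.
- by move=> [[+ _] sv]; rewrite (state_That sv) (negbTE hv).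
Qed.

Let measurable_bad k : measurable (bad k).
Proof.
suff [] : indep_of Pr Y (past k.+1) (bad k) by [].
apply: (@indep_of_partition _ _ _ _ _ _ _ mY _ (state k)) => v;
  rewrite bad_state.
case: ifPn => _; last exact: indep_of_set0.
set m := sample_size _ _ _ _.
apply: (indep_of_sub _ (indep_of_partial_sum_in mY (@sL k.+1) (@pair_inj k.+1)
  (fresh k)
  (indep_of_state k v) m _)).
move=> [k' s] /orP[h|/mapP[s' _ [-> _]]]; first exact: ltnW.
by rewrite /past.
Qed.

Let prob_bad k : prob Pr (bad k) <= alpha / (2 ^ k.+2)%:R.
Proof.
have c0 : 0 <= alpha / (2 ^ k.+2)%:R by rewrite divr_ge0 // ltW.
have mst v : measurable (state k @^-1` [set v]) by case: (indep_of_state k v).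
apply: (prob_le_fibres c0 mst) => [v|v]; first exact: measurableI.
rewrite bad_state; case: ifPn => hv; last first.
  by rewrite prob_set0 mulr_ge0 // prob_ge0.
(* The previous estimate is a divisor in the sample size, and its positivity is known only for
   states that some run attains. *)
case: (pselect (exists w, state k w = v)) => [[w sv]|nv]; last first.
  rewrite (_ : _ `&` _ = set0); first by rewrite prob_set0 mulr_ge0 // prob_ge0.
  by apply/seteqP; split => // w [/= sv _]; apply: nv; exists w.
have kv : (k = 0%N) \/ 0 < v.2%:R / v.1%:R :> R.
  rewrite -(state_That sv); case: (k) => [|k']; [by left|right].
  by have [_ /andP[T1 _]] := run_bounds k' w; rewrite (lt_le_trans _ T1).
have e02 : 0 <= e <= 2^-1 by rewrite ltW.
have Lth s w' : (len (k.+1, s) w' <=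
  theta k.+1)%N by exact/stop_length_le/theta_gt0.
have pL s v' : (v' <= theta k.+1)%N ->
    prob Pr (len (k.+1, s) @^-1` [set v']) = stop_pmf i P (theta k.+1) v'.
  by move=> _; exact: (prob_stop_length (mcY (k.+1, s)) _ (theta_gt0 k.+1)).
have p0 v' : 0 <= stop_pmf i P (theta k.+1) v'.
  by rewrite -(prob_stop_length (mcY (0%N, 0%N)) _ (theta_gt0 k.+1)) prob_ge0.
apply: le_trans (partial_sum_deviation mY (@sL k.+1) (@pair_inj k.+1) (fresh k)
  (indep_of_state k v) Lth pL (theta_gt0 k.+1) p0 (sum_stop_pmf i P _) _ e02) _.
rewrite mean_stop_pmf ler_wpM2l ?prob_ge0 //.
exact: sample_size_suffices.
Qed.

Definition run_accurate w :=
  forall k, (1 - e) * mu k.+1 <= That k.+1 w <= (1 + e) * mu k.+1.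

(** The failure probabilities sum to at most [alpha / 2], which leaves room for the strict
    inequality. *)
Lemma run_accurate_event : exists G : set Om,
  [/\ measurable G, ((1 - alpha)%:E < Pr G)%E & forall w, G w -> run_accurate
    w].
Proof.
pose B := \bigcup_k bad k.
have mB : measurable B by apply: bigcup_measurable => k _;
  exact: measurable_bad.
have PB : (Pr B <= (alpha / 2)%:E)%E.
  apply: le_trans (measure_sigma_subadditive Pr measurable_bad mB _) _ => //.
  apply: le_trans (_ : (\sum_(0 <= k <oo) (alpha / 2 / (2 ^ k.+1)%:R)%:E <=
    _)%E).
    apply: lee_nneseries => [k _ _|k _]; first exact: measure_ge0.
    rewrite [X in (X <= _)%E](probE Pr (@measurable_bad k)) lee_fin;
      apply: le_trans (prob_bad k) _.
    by rewrite expnS natrM invfM mulrA.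
  by apply: epsilon_trick0; rewrite divr_ge0 // ltW.
exists (~` B); split; first exact: measurableC.
  rewrite probability_setC // probE // -EFinB lte_fin.
  by move: PB (alpha0) => + a0; rewrite probE // lee_fin; lra.
move=> w nBw.
have nbad k : ~ bad k w by move=> bk; apply: nBw; exists k.
have step k : That k w <= (1 + e) * mu k ->
    (1 - e) * mu k.+1 <= That k.+1 w <= (1 + e) * mu k.+1.
  move=> Tk; have [N0 _] := run_bounds k w.
  have N0' : (0 : R) < (N k.+1 w)%:R by rewrite ltr0n.
  have : ~~ off_mean (theta k.+1) (stop_pmf i P (theta k.+1)) e (N k.+1 w) (W
    k.+1 w).
    by apply/negP => off; apply: (nbad k); split.
  rewrite /off_mean mean_stop_pmf -/(mu k.+1) negb_or -!ltNge => /andP[lo hi].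
  rewrite That_E ler_pdivlMr // ler_pdivrMr //.
  by rewrite -!mulrA [mu _ * _]mulrC !ltW.
(* The default value [T_hat 0 = 0] meets the upper bound, so the first iteration needs no separate
   argument; afterwards each estimate licenses the next. *)
elim=> [|k /andP[_ IH]]; apply: step => //.
rewrite /That /= mulr_ge0 // ?(le_trans ler01) ?trunc_mean_ge1 //.
by rewrite lerDl ltW.
Qed.

(** Truncation puts [pi_i mu] in [1 - e, 1] and sampling adds a factor within [1 +- e], so [pi_i]
    times the estimate lies between [(1 - e)^2] and [1 + e]. *)
Lemma run_accurate_in_pm w k : run_accurate w ->
  2 * Zmax P pi i * surv P i (theta k.+1) i <= e ->
  in_pm (2 * e) (pi 0 i) (pi_hat i e alpha (fun k s t => Y (k, s) t w) k.+1).
Proof.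
move=> /(_ k) /andP[lo hi] trunc.
have [_ /andP[T1 _]] := run_bounds k w.
rewrite /in_pm /pi_hat -/(That k.+1 w) -(div1r (That _ _)) !mulrA !mulr1.
have T0 : 0 < That k.+1 w by rewrite (lt_le_trans _ T1).
rewrite ler_pdivrMr // ler_pdivlMr //.
have pi0 := stationary_gt0 i stochP irrP statP.
have := trunc_return i stochP irrP statP (theta_gt0 k.+1);
  rewrite -/(mu k.+1) => tr.
have := trunc_mean_le k.+1.
move: (e0) (e2) => e0' e2' pimu.
have lo' : (1 - e) * (pi 0 i * mu k.+1) <= pi 0 i * That k.+1 w.
  by rewrite mulrCA ler_pM2l.
have hi' : pi 0 i * That k.+1 w <= (1 + e) * (pi 0 i * mu k.+1).
  by rewrite [leRHS]mulrCA ler_pM2l.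
have tr' := le_trans tr trunc.
move: (pi 0 i * mu k.+1) (pi 0 i * That k.+1 w) pimu tr' lo' hi' =>
  q T' pimu tr' lo' hi'.
apply/andP; split; nra.
Qed.

(** Here [27 = 3 * (3/2) * 6]: [1 + e <= 3/2], and consecutive estimates have ratio at most 6, since
    [1 + e <= 3/2], [1 - e >= 1/2] and the truncated mean at most doubles. One more unit pays for
    rounding up. *)
Let step_le k w : run_accurate w ->
  (N k.+1 w)%:R * That k.+1 w <=
  28 * (theta k.+1)%:R * ln (4 * (theta k.+1)%:R / alpha) / e ^+ 2.
Proof.
move=> acc; have ee : 0 < e ^+ 2 by rewrite exprn_gt0.
have l1 := ln_theta_ge1 k.
set l := ln (4 * (theta k.+1)%:R / alpha) in l1 *.
have t1 := theta_ge1 k.+1.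
have [_ /andP[T1 Tt]] := run_bounds k w.
have T0 : 0 < That k.+1 w by rewrite (lt_le_trans _ T1).
have prev : (k = 0%N) \/ 0 < That k w.
  case: (k) => [|k']; [by left|right].
  by have [_ /andP[T1' _]] := run_bounds k' w; rewrite (lt_le_trans _ T1').
have /andP[_ Nle] := sample_size_bounds prev.
have a27 : sample_arg k (That k w) * That k.+1 w <=
  27 * (theta k.+1)%:R * l / e ^+ 2.
  have [e0' e2'] : 0 < e /\ e <= 2^-1 by [].
  rewrite ler_pdivlMr // /l; clear l l1.
  case: k acc t1 T1 Tt T0 prev {Nle} => [|k] acc t1 T1 Tt T0 prev.
    rewrite /sample_arg ln8; have := ln_theta_ge1 0.
    move: (ln (4 * (theta 1)%:R / alpha)) => l l1.
    rewrite [leLHS](_ : _ = l * (6 * (1 + e) * That 1 w)); last by field;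
      rewrite lt0r_neq0.
    rewrite [leRHS](_ : _ = l * (27 * (theta 1)%:R)); last by ring.
    by rewrite ler_pM2l ?(lt_le_trans _ l1) //; nra.
  have [//|Tk0] := prev.
  rewrite /sample_arg; have := ln_theta_ge1 k.+1.
  move: (ln (4 * (theta k.+2)%:R / alpha)) => l l1.
  rewrite [leLHS](_ : _ = l * (theta k.+2)%:R * (3 * (1 + e) * That k.+2 w /
    That k.+1 w)); last first.
    by field; rewrite !lt0r_neq0.
  rewrite [leRHS](_ : _ = l * (theta k.+2)%:R * 27); last by ring.
  rewrite ler_pM2l ?mulr_gt0 ?(lt_le_trans _ l1) ?(lt_le_trans _ t1) //.
  rewrite ler_pdivrMr //.
  have /andP[_ hi] := acc k.+1; have /andP[lo _] := acc k.
  have /andP[_ mm] := trunc_meanS k.+1; have m1 := trunc_mean_ge1 k.+1.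
  have Thi : That k.+2 w <= 3 * mu k.+1 by nra.
  have Tlo : mu k.+1 <= 2 * That k.+1 w by nra.
  nra.
apply: le_trans (_ : (sample_arg k (That k w) + 1) * That k.+1 w <= _).
  by rewrite ler_pM2r.
rewrite mulrDl mul1r [leRHS](_ : _ = 27 * (theta k.+1)%:R * l / e ^+ 2 + (theta
  k.+1)%:R * (l / e ^+ 2)); last by ring.
apply: lerD a27 _; apply: le_trans Tt _.
rewrite ler_peMr ?(le_trans ler01) // ler_pdivlMr // mul1r (le_trans _ l1) //.
by rewrite expr_le1 ?(ltW e0) // (le_trans e2) // invf_le1 // ler1n.
Qed.

(** Doubling of the threshold makes the last iteration dominate: [56 t + 28 (2 t) = 56 (2 t)]. *)
Lemma steps_le w k : run_accurate w ->
  steps i e alpha (fun k s t => Y (k, s) t w) k.+1 <=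
  56 * (theta k.+1)%:R * ln (4 * (theta k.+1)%:R / alpha) / e ^+ 2.
Proof.
move=> acc; have ee : 0 < e ^+ 2 by rewrite exprn_gt0.
have term l : (N_samples i e alpha (fun k s t => Y (k, s) t w) l.+1)%:R *
    T_hat i e alpha (fun k s t => Y (k, s) t w) l.+1 <=
  28 * (theta l.+1)%:R * ln (4 * (theta l.+1)%:R / alpha) / e ^+ 2 :=
    step_le l acc.
elim: k => [|k IH].
  rewrite /steps big_nat1; apply: le_trans (term 0%N) _.
  have l1 := ln_theta_ge1 0; have t1 := theta_ge1 1.
  by rewrite ler_pM2r ?invr_gt0 // !ler_pM2r ?(lt_le_trans _ l1) ?(lt_le_trans
    _ t1) // ler_nat.
rewrite /steps big_nat_recr //= -/(steps _ _ _ _ _).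
apply: le_trans (lerD IH (term _)) _; rewrite -mulrDl.
apply: ler_wpM2r; first by rewrite invr_ge0 ltW.
have t1 := theta_ge1 k.+1; rewrite [(theta k.+2)%:R]thetaS.
have t0 : 0 < (theta k.+1)%:R :> R by rewrite (lt_le_trans _ t1).
have : ln (4 * (theta k.+1)%:R / alpha) <=
  ln (4 * (2 * (theta k.+1)%:R) / alpha).
  rewrite ler_ln ?posrE ?divr_gt0 ?mulr_gt0 // ler_pM2r ?invr_gt0 // ler_pM2l
    //.
  by apply: ler_peMl; [exact: ltW|rewrite ler1n].
move: (ln (4 * (theta k.+1)%:R / alpha)) (ln _) => a b; nra.
Qed.

End IteratedRefinement.

(** * Asymptotic bounds *)

Section Logarithms.
Context {R : realType}.
Implicit Types x y f : R.

Lemma ln_le_subr1 x : 0 < x -> ln x <= x - 1.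
Proof.
by move=> x0; have := @le_ln1Dx R (x - 1); rewrite addrCA subrr addr0; apply;
  lra.
Qed.

Lemma ln2_ge : 2^-1 <= ln 2 :> R.
Proof.
have := @ln_le_subr1 2^-1; rewrite lnV ?posrE //; lra.
Qed.

Lemma ln_ge1 x : 3 <= x -> 1 <= ln x.
Proof.
move=> x3; rewrite -[X in X <= _](@expRK R) ler_ln ?posrE ?expR_gt0 //;
  last by lra.
exact: le_trans expR1_le3 x3.
Qed.

Lemma log2_le_theta x k : 0 < x -> (log2 x <= k%:R) = (x <= (theta k)%:R).
Proof.
move=> x0; have l2 := ln2_ge.
rewrite /log2 ler_pdivrMr; last by lra.
by rewrite mulr_natl -lnXn // -natrX ler_ln ?posrE // ltr0n theta_gt0.
Qed.

Lemma theta_cover x : 1 <= x -> exists k, x <= (theta k.+1)%:R <= 2 * x.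
Proof.
move=> x1; have ex : exists k, x <= (theta k.+1)%:R.
  exists (Num.trunc x); apply: ltW; apply: lt_le_trans (truncnS_gt x) _.
  by rewrite ler_nat /theta ltnW // ltn_expl.
case: (ex_minnP ex) => k xk mink; exists k; rewrite xk /=.
case: k xk mink => [|k] xk mink; first by rewrite /theta expn1; lra.
rewrite thetaS ler_pM2l // ltW // ltNge; apply/negP => /mink.
by rewrite ltnn.
Qed.

Definition soft c f : R := f * (1 + `|ln f|) ^+ c.

Lemma soft_ge0 c f : 0 <= f -> 0 <= soft c f.
Proof. by move=> f0; rewrite mulr_ge0 // exprn_ge0 // addr_ge0. Qed.

Lemma le_soft c f : 0 <= f -> f <= soft c f.
Proof. by move=> f0; rewrite ler_peMr // exprn_ege1 // lerDl. Qed.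

Lemma soft_le c c' f : 0 <= f -> (c <= c')%N -> soft c f <= soft c' f.
Proof.
by move=> f0 cc'; rewrite ler_wpM2l // ler_weXn2l // lerDl.
Qed.

Lemma softO4 (C : R) c f1 f2 f3 f4 :
  softO C c [:: f1; f2; f3;
    f4] = C * (soft c f1 * soft c f2 * soft c f3 * soft c f4).
Proof. by rewrite /softO !big_cons big_nil mulr1 !mulrA. Qed.

Lemma add_le_mul3 x y : 0 <= x -> 0 <= y -> 2 + x + y <=
  2 * ((1 + x) * (1 + y)).
Proof. by move=> x0 y0; nra. Qed.

End Logarithms.

Section Asymptotics.
Context (R : realType) (n : nat) (P : 'M[R]_n) (pi : 'rV[R]_n) (i : 'I_n).
Hypotheses (stochP : stochastic P) (irrP : irreducible P)
  (statP : stationary P pi).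

Local Notation H := (hit_max P pi i).
Local Notation Z := (Zmax P pi i).

Lemma Zmax_gt0 : 0 < Z.
Proof. by have := Zmax_ge i stochP irrP statP; lra. Qed.

(** Blocks of floor(2 H) steps, floor(l) of them, fit into [th]. Rounding [l] down loses at most one
    halving, hence the factor 2. *)
Lemma surv_cutoff th (l : R) : 0 <= l -> 2 * H * l <= th%:R ->
  surv P i th i <= 2 * expR (- (l * ln 2)).
Proof.
move=> l0 Hth; have H1 := hit_max_ge1 i stochP irrP statP.
set b := Num.trunc (2 * H); set m := Num.trunc l.
have bH : 2 * H <= b.+1%:R by exact/ltW/truncnS_gt.
have bH' : b%:R <= 2 * H by rewrite truncn_le; lra.
have ml : m%:R <= l by rewrite truncn_le.
have lm : l <= m.+1%:R by exact/ltW/truncnS_gt.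
have mb : (m * b <= th)%N.
  rewrite -(ler_nat R) natrM; apply: le_trans Hth; rewrite mulrC.
  by apply: ler_pM.
apply: le_trans (surv_le i stochP i mb) _.
apply: le_trans (surv_block stochP irrP statP m _ bH) _.
rewrite -[X in X ^+ _](@lnK R) ?posrE ?invr_gt0 // -expRM_natl lnV ?posrE //.
rewrite -[X in _ <= X * _](@lnK R 2) ?posrE // -expRD ler_expR.
have := @ln2_ge R; move: lm; rewrite -natr1; nra.
Qed.

Section Cutoff.
Variable eps : R.
Hypothesis eps01 : 0 < eps < 1.
Local Notation cutoff := (2 * H * log2 (8 * Z / eps)).

Lemma log2_cutoff_ge1 : 1 <= log2 (8 * Z / eps).
Proof.
have Z3 := Zmax_ge i stochP irrP statP; case/andP: (eps01) => a b.
have l2 := @ln2_ge R.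
rewrite /log2 ler_pdivlMr ?mul1r; last by lra.
have h : 2 <= 8 * Z / eps by rewrite ler_pdivlMr //; lra.
by rewrite ler_ln ?posrE //; lra.
Qed.

Lemma cutoff_ge1 : 1 <= cutoff.
Proof.
have := log2_cutoff_ge1; have := hit_max_ge1 i stochP irrP statP.
by move: (log2 _) (H) => l h h1 l1; nra.
Qed.

(** The 8 in the cutoff is accounted for by the 2 in the bias bound, the rounding factor 2 of
    [surv_cutoff] and the target [eps / 2]. *)
Lemma Zmax_surv_cutoff th : cutoff <= th%:R ->
  2 * Z * surv P i th i <= eps / 2.
Proof.
move=> cth; have Z0 := Zmax_gt0; case/andP: (eps01) => a b.
have := surv_cutoff (le_trans ler01 log2_cutoff_ge1) cth.
have l2 : ln 2 != 0 :> R by have := @ln2_ge R; lra.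
rewrite /log2 divfK // expRN lnK ?posrE ?divr_gt0 ?mulr_gt0 // invf_div => h.
have := ler_wpM2l (ltW (mulr_gt0 (ltr0Sn R 1) Z0)) h.
rewrite [X in _ <= X -> _](_ : _ = eps / 2) //.
by field; rewrite lt0r_neq0.
Qed.

Hypothesis eps9 : eps < 9^-1.

(** With [Z >= 1/3], the bound [eps < 1/9] gives [Z / eps >= 3], which exceeds Euler's number. *)
Lemma ln_Zmax_ge1 : 1 <= ln (Z / eps).
Proof.
have Z3 := Zmax_ge i stochP irrP statP; case/andP: (eps01) (eps9) => a b c.
by apply: ln_ge1; rewrite ler_pdivlMr //; lra.
Qed.

Lemma cutoff_le : cutoff <= 32 * H * ln (Z / eps).
Proof.
have L1 := ln_Zmax_ge1; have H1 := hit_max_ge1 i stochP irrP statP.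
have Z0 := Zmax_gt0; case/andP: (eps01) => a b.
have l2 := @ln2_ge R.
have l8 : ln 8 <= 7 :> R by have := @ln_le_subr1 R 8; lra.
have E : ln (8 * Z / eps) = ln 8 + ln (Z / eps).
  by rewrite -mulrA lnM ?posrE ?divr_gt0.
rewrite [leRHS](_ : _ = 2 * H * (16 * ln (Z / eps))); last by ring.
rewrite ler_pM2l; last by lra.
rewrite /log2 E ler_pdivrMr; last by lra.
by move: (ln 8) (ln 2) (ln (Z / eps)) L1 l2 l8 => a8 a2 L L1 l2 l8; nra.
Qed.

(** In the constant, [224 = 56 * 4] comes from the square of [eps / 2], [64 = 2 * 32] from the
    overshoot and [cutoff_le], and 256 from the logarithm of the threshold. A sum of logarithms is
    bounded by a product of factors that are at least 1. *)
Lemma steps_softO alpha k : 0 < alpha -> alpha < 3^-1 ->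
  (theta k)%:R <= 2 * cutoff ->
  56 * (theta k)%:R * ln (4 * (theta k)%:R / alpha) / (eps / 2) ^+ 2 <=
  softO (224 * 64 * 256) 1 [:: H; ln (1 / alpha); 1 / eps ^+ 2; ln (Z / eps)].
Proof.
move=> al0 al3 th; have L1 := ln_Zmax_ge1.
have H1 := hit_max_ge1 i stochP irrP statP; case/andP: (eps01) => a b.
have {}th : (theta k)%:R <= 64 * H * ln (Z / eps).
  by apply: le_trans th _; have := cutoff_le; move: cutoff => B; lra.
have A1 : 1 <= ln (1 / alpha) by apply: ln_ge1; rewrite ler_pdivlMr //; lra.
have t1 := @theta_ge1 R k.
move: (theta k)%:R t1 th => t t1 th.
move: (ln (Z / eps)) L1 th => L L1 th; move: H H1 th => h h1 th.
have lh := ln_ge0 h1; have lL := ln_ge0 L1.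
have [t0 h0 L0] : [/\ 0 < t, 0 < h & 0 < L] by split; lra.
(* [256 = 4 * 64]: the 4 stands in the logarithm of the sample size, the 64 bounds the threshold. *)
have [K [KE K0 lK]] : exists K : R, [/\ K = 256, 0 < K & ln K <= K - 1].
  exists 256; have K0 : 0 < 256 :> R by rewrite ltr0n.
  by split; [|exact: K0|exact: ln_le_subr1 K0].
have la : ln (4 * t / alpha) <= K * ((1 + ln h) * (1 + ln L) * ln (1 / alpha)).
  have ia0 : 0 < 1 / alpha by rewrite divr_gt0.
  have KhL : 0 < K * h * L by rewrite !mulr_gt0.
  apply: le_trans (_ : ln (K * h * L * (1 / alpha)) <= _).
    rewrite ler_ln ?posrE ?mulr_gt0 ?invr_gt0 // mul1r ler_pM2r ?invr_gt0 //
      KE; lra.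
  rewrite (lnM KhL) ?posrE // (@lnM _ (K * h)) ?posrE ?mulr_gt0 // (@lnM _ K)
    ?posrE //.
  move: (ln h) (ln L) (ln (1 / alpha)) (ln K) lh lL A1 lK =>
    x y z q x0 y0 z1 q0.
  have : 1 + x + y <= (1 + x) * (1 + y) by nra.
  move: ((1 + x) * (1 + y)) => w wxy.
  have wz : w <= w * z by rewrite ler_peMr //; lra.
  have zw : z <= w * z by rewrite ler_peMl //; lra.
  have K2 : 2 <= K by rewrite KE ler_nat.
  have g1 : 0 <= (K - 1) * (w * z - w) by apply: mulr_ge0; lra.
  have g2 : 0 <= (K - 2) * (w - 1) by apply: mulr_ge0; lra.
  by clear KE; lra.
have e0 : 0 < eps ^+ 2 by rewrite exprn_gt0.
have lt0 : 0 <= ln (4 * t / alpha) by apply: ln_ge0; rewrite ler_pdivlMr //;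
  lra.
have sh : soft 1 h = h * (1 + ln h) by rewrite /soft expr1 ger0_norm.
have sL : soft 1 L = L * (1 + ln L) by rewrite /soft expr1 ger0_norm.
move: (ln (1 / alpha)) (ln (4 * t / alpha)) A1 la lt0 => x y x1 yx y0.
have x0 : 0 <= x by lra.
rewrite softO4 sh sL.
have q0 : 0 <= 1 / eps ^+ 2 by rewrite divr_ge0 // ltW.
have hh : 0 <= h * (1 + ln h) by rewrite mulr_ge0 ?addr_ge0 ?(ltW h0).
have LL : 0 <= L * (1 + ln L) by rewrite mulr_ge0 ?addr_ge0 ?(ltW L0).
rewrite -KE; set C := 224 * 64 * K.
have C0 : 0 <= C by rewrite /C !mulr_ge0 ?ler0n // ltW.
apply: le_trans (_ : C * (h * (1 + ln h) * x * (1 / eps ^+ 2) * (L * (1 + ln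
  L))) <= _); last first.
  apply: ler_wpM2l => //; apply: ler_wpM2r => //.
  apply: ler_pM => //; [exact: mulr_ge0| |exact: le_soft].
  by apply: ler_wpM2l => //; exact: le_soft.
have -> : 56 * t * y / (eps / 2) ^+ 2 = 224 / eps ^+ 2 * (t * y).
  by field; rewrite lt0r_neq0.
have -> : C * (h * (1 + ln h) * x * (1 / eps ^+ 2) * (L * (1 + ln L))) =
    224 / eps ^+ 2 * ((64 * h * L) * (K * ((1 + ln h) * (1 + ln L) * x))).
  by rewrite /C; field; rewrite lt0r_neq0.
apply: ler_wpM2l; first by rewrite divr_ge0 ?ler0n // ltW.
by apply: ler_pM => //; exact: ltW.
Qed.

End Cutoff.

(** * Comparison with the mixing time *)

Section MixingBounds.
Variables (eps : R) (tm : nat).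
Hypotheses (eps01 : 0 < eps < 1) (mixtm : is_tmix P pi tm) (tm0 : (0 < tm)%N).
Local Notation cutoff := (2 * H * log2 (8 * Z / eps)).

Let tm1 : 1 <= tm%:R :> R. Proof. by rewrite ler1n. Qed.

Lemma Zmax_le3_mix : Z <= 3 * tm%:R.
Proof.
have [mx _] := mixtm; have := Zmax_le_mix i stochP irrP statP mx.
by move: (tm1) => t1; lra.
Qed.

Lemma inv_stationary_ge1 : 1 <= 1 / pi 0 i.
Proof.
by rewrite ler_pdivlMr ?mul1r ?(stationary_le1 i statP) // (stationary_gt0 i
  stochP irrP statP).
Qed.

Lemma hit_max_le_inv : H <= 2 * tm%:R * (1 / pi 0 i).
Proof.
by have [mx _] := mixtm; rewrite mulrA mulr1; exact: hit_max_le_mix.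
Qed.

(** [eps < expR (-3)] makes [ln (tm / eps) >= 3], so the product [D] is at least 3 and [ln D >= 1].
    Then [192 = 2 * 2 * 48] bounds the cutoff by [192 D], and [384 = 2 * (191 + 1)] absorbs
    [ln 192 <= 191] and [ln 2 >= 1/2]. *)
Lemma cutoff_le_mix : eps < expR (-3) ->
  log2 cutoff <= 384 * ln (tm%:R / pi 0 i * ln (tm%:R / eps)).
Proof.
move=> eps3; case/andP: (eps01) (tm1) => a b t1.
have Z0 := Zmax_gt0; have Z3 := Zmax_le3_mix.
have p1 := inv_stationary_ge1; have Hp := hit_max_le_inv.
have l2 := @ln2_ge R.
have te : 0 < tm%:R / eps by rewrite divr_gt0 // (lt_le_trans _ t1).
have L3 : 3 <= ln (tm%:R / eps).
  rewrite -[X in X <= _](@expRK R) ler_ln ?posrE ?expR_gt0 //.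
  rewrite ler_pdivlMr // -[3]opprK expRN mulrC ler_pdivrMr ?expR_gt0 //.
  by apply: le_trans (ltW eps3) _; rewrite ler_peMl // expR_ge0.
have lc : log2 (8 * Z / eps) <= 48 * ln (tm%:R / eps).
  rewrite /log2 ler_pdivrMr; last by lra.
  have n24 : 0 < 24 :> R by rewrite ltr0n.
  apply: le_trans (_ : ln (24 * (tm%:R / eps)) <= _).
    rewrite ler_ln ?posrE; [|by rewrite divr_gt0 ?mulr_gt0|exact: mulr_gt0].
    by rewrite mulrA ler_pM2r ?invr_gt0 //; lra.
  rewrite (lnM n24 te); have := ln_le_subr1 n24.
  by move: (ln 24) (ln 2) (ln (tm%:R / eps)) l2 L3 => x y z l2 L3 x1; nra.
set D := tm%:R / pi 0 i * ln (tm%:R / eps).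
have DE : D = tm%:R * (1 / pi 0 i) * ln (tm%:R / eps) by rewrite /D mul1r.
have D3 : 3 <= D.
  rewrite DE; apply: (le_trans L3); rewrite ler_peMl //; last by nra.
  by rewrite (le_trans _ L3).
have lD := ln_ge1 D3.
have cD : cutoff <= 192 * D.
  have l1 := log2_cutoff_ge1 eps01.
  rewrite DE [leRHS](_ : _ = 2 * (2 * tm%:R * (1 / pi 0 i)) * (48 * ln (tm%:R /
    eps))); last by ring.
  have H1 := hit_max_ge1 i stochP irrP statP.
  apply: ler_pM => //; [by apply: mulr_ge0; lra|by lra|by rewrite ler_pM2l].
have c1 := cutoff_ge1 eps01.
have n192 : 0 < 192 :> R by rewrite ltr0n.
have D0 : 0 < D by rewrite (lt_le_trans _ D3).
apply: le_trans (_ : log2 (192 * D) <= _).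
  rewrite /log2 ler_pM2r ?invr_gt0; last by lra.
  by rewrite ler_ln ?posrE; [exact: cD|exact: lt_le_trans c1|exact: mulr_gt0].
rewrite /log2 ler_pdivrMr; last by lra.
rewrite (lnM n192 D0); have := ln_le_subr1 n192.
by move: (ln 192) (ln 2) (ln D) l2 lD => x y z l2 lD x1; nra.
Qed.

(** The factor [ln (Z / eps)] has no counterpart on the right, so it is absorbed, with its own
    correction, into the polylogarithms of [tm] and [1 / eps ^+ 2]. That costs [c + 1] extra powers
    on top of [c], and each of [sH] and [sL] contributes [2 ^+ c.+1]. *)
Lemma soft_le_mix (C alpha : R) c : 0 < C -> eps < 9^-1 -> 0 < alpha < 1 ->
  softO C c [:: H; ln (1 / alpha); 1 / eps ^+ 2; ln (Z / eps)] <=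
  softO (C * 2 ^+ (c + c).+2) (c + c).+1
    [:: tm%:R; ln (1 / alpha); 1 / pi 0 i; 1 / eps ^+ 2].
Proof.
move=> C0 eps9 /andP[al0 al1].
have A0 : 0 <= ln (1 / alpha) by apply: ln_ge0;
  rewrite ler_pdivlMr ?mul1r // ltW.
have L1 := ln_Zmax_ge1 eps01 eps9; have H1 := hit_max_ge1 i stochP irrP statP.
have p1 := inv_stationary_ge1; have Hp := hit_max_le_inv.
have Z3 := Zmax_le3_mix; have Z0 := Zmax_gt0.
case/andP: (eps01) (tm1) => a b t1.
have q1 : 1 <= 1 / eps by rewrite ler_pdivlMr ?mul1r ?ltW.
have Lle : ln (Z / eps) <= 2 * ((1 + ln tm%:R) * (1 + ln (1 / eps ^+ 2))).
  have n3 : 0 < 3 :> R by rewrite ltr0n.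
  have t0 : 0 < tm%:R :> R by rewrite (lt_le_trans _ t1).
  have t3 := mulr_gt0 n3 t0;
    have ie : 0 < 1 / eps by rewrite (lt_le_trans _ q1).
  apply: le_trans (_ : ln (3 * tm%:R * (1 / eps)) <= _).
    rewrite ler_ln ?posrE; [|exact: divr_gt0|exact: mulr_gt0].
    by rewrite mul1r ler_pM2r ?invr_gt0.
  have -> : 1 / eps ^+ 2 = (1 / eps) ^+ 2 by rewrite !div1r exprVn.
  rewrite (lnM t3 ie) (lnM n3 t0) lnXn //; have := ln_le_subr1 n3.
  have := ln_ge0 t1; have := ln_ge0 q1.
  move: (ln 3) (ln tm%:R) (ln (1 / eps)) => x y z z0 y0 x2.
  by rewrite mulr2n; nra.
have q1' : 1 <= 1 / eps ^+ 2.
  by rewrite ler_pdivlMr ?exprn_gt0 // mul1r expr_le1 ?ltW.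
move: (1 / eps ^+ 2) (ln (Z / eps)) q1' Lle L1 => q L q1' Lle L1.
move: (ln (1 / alpha)) (tm%:R) (1 / pi 0 i) A0 t1 p1 Hp Lle =>
  x t p x0 t1 p1 Hp Lle.
have [lt0 lp0 lq0] := And3 (ln_ge0 t1) (ln_ge0 p1) (ln_ge0 q1').
have [t0 p0 q0] : [/\ 0 < t, 0 < p & 0 < q] by split; lra.
have lH := ln_ge0 H1; have lL := ln_ge0 L1.
have sH : soft c H <= 2 ^+ c.+1 * (soft c t * soft c p).
  have -> : 2 ^+ c.+1 * (soft c t * soft c p) =
      (2 * t * p) * (2 * ((1 + ln t) * (1 + ln p))) ^+ c.
    by rewrite /soft !ger0_norm // exprS !exprMn; ring.
  rewrite /soft ger0_norm //; apply: ler_pM => //; first by lra.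
    by rewrite exprn_ge0 // addr_ge0.
  apply: lerXn2r; rewrite ?nnegrE ?addr_ge0 ?mulr_ge0 ?addr_ge0 //.
  have n2 : 0 < 2 :> R by rewrite ltr0n.
  apply: le_trans (_ : 1 + ln (2 * t * p) <= _).
    by rewrite lerD2l ler_ln ?posrE ?mulr_gt0 //; lra.
  rewrite (@lnM _ (2 * t)) ?posrE ?mulr_gt0 // (lnM n2 t0).
  have := ln_le_subr1 n2; have := add_le_mul3 lt0 lp0; lra.
(* Since [1 + ln L <= L], the whole soft factor of [L] is at most [L ^+ c.+1]. *)
have sL : soft c L <= 2 ^+ c.+1 * ((1 + ln t) ^+ c.+1 * (1 + ln q) ^+ c.+1).
  rewrite -!exprMn; apply: le_trans (_ : L ^+ c.+1 <= _).
    rewrite /soft exprS ger0_norm //; apply: ler_wpM2l; first by lra.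
    apply: lerXn2r; rewrite ?nnegrE ?addr_ge0 //; first by lra.
    by have := @ln_le_subr1 R L; lra.
  by apply: lerXn2r; rewrite ?nnegrE ?mulr_ge0 ?addr_ge0 // (le_trans ler01).
rewrite !softO4.
have s0 f k : 0 <= f -> 0 <= soft k f := @soft_ge0 R k f.
have E : (c + c).+1 = (c + c.+1)%N by rewrite addnS.
have st : soft (c + c).+1 t = soft c t * (1 + ln t) ^+ c.+1.
  by rewrite /soft ger0_norm // E exprD mulrA.
have sq : soft (c + c).+1 q = soft c q * (1 + ln q) ^+ c.+1.
  by rewrite /soft ger0_norm // E exprD mulrA.
have cc : (c <= (c + c).+1)%N by rewrite ltnW // ltnS leq_addr.
rewrite -[leRHS]mulrA ler_pM2l // st sq.
rewrite [leRHS](_ : _ = (2 ^+ c.+1 * (soft c t * soft (c + c).+1 p)) * soft (c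
  + c).+1 x * soft c q *
   (2 ^+ c.+1 * ((1 + ln t) ^+ c.+1 * (1 + ln q) ^+ c.+1))); last first.
  rewrite (_ : (c + c).+2 = (c.+1 + c.+1)%N) ?exprD;
    last by rewrite addnS addSn.
  by ring.
have H0 := le_trans ler01 H1.
apply: ler_pM => //; first by rewrite !mulr_ge0 ?s0 // ltW.
  by rewrite s0 // (le_trans ler01).
apply: ler_pM => //; [by rewrite mulr_ge0 ?s0|by rewrite s0 ?ltW| ].
apply: ler_pM; [exact: s0|exact: s0| |exact: soft_le].
apply: le_trans sH _; apply: ler_wpM2l; first exact: exprn_ge0.
by apply: ler_wpM2l; [exact/s0/ltW|apply: soft_le => //; exact: ltW].
Qed.

End MixingBounds.

End Asymptotics.

Theorem corollary1 (R : realType) :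
  (* accuracy for all large k and step count, on one event of probability
     greater than 1 - alpha *)
  (exists (C eps0 alpha0 : R) (c : nat), [/\ 0 < C, 0 < eps0 & 0 < alpha0] /\
    forall (n : nat) (P : 'M[R]_n) (pi : 'rV[R]_n) (i : 'I_n) (eps alpha : R)
      (d0 : measure_display) (Om0 : measurableType d0)
      (PP : 'I_n -> probability Om0 R) (X : nat -> Om0 -> 'I_n)
      (d : measure_display) (Om : measurableType d) (Pr : probability Om R)
      (Y : nat * nat -> nat -> Om -> 'I_n),
      stochastic P -> irreducible P -> stationary P pi ->
      markov_family PP P X ->
      (forall ks : nat * nat, markov_chain Pr P i (Y ks)) ->
      independent_processes Pr Y ->
      0 < eps < 1 -> 0 < alpha < 1 ->
      let x (w : Om) (k s t : nat) : 'I_n := Y (k, s) t w in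
      let accurate (w : Om) (k : nat) : Prop :=
        in_pm eps (pi 0 i) (pi_hat i (eps / 2) alpha (x w) k) in
      exists G : set Om,
        [/\ measurable G,
            ((1 - alpha)%:E < Pr G)%E
          & forall w, G w ->
            (forall k : nat, (1 <= k)%N ->
               log2 (2 * H_max PP X i * log2 (8 * Zmax P pi i / eps)) <= k%:R ->
               accurate w k)
            /\
            (eps < eps0 -> alpha < alpha0 ->
               exists k : nat,
                 [/\ (1 <= k)%N,
                     forall l : nat, (k <= l)%N -> accurate w l
                   & steps i (eps / 2) alpha (x w) k <=
                     softO C c [:: H_max PP X i; ln (1 / alpha); 1 / eps ^+ 2;
                                   ln (Zmax P pi i / eps)]])])
  /\
  (* the threshold on k is O(ln (tmix / pi_i * ln (tmix / eps))) *)
  (exists C eps0 : R, [/\ 0 < C & 0 < eps0] /\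
    forall (n : nat) (P : 'M[R]_n) (pi : 'rV[R]_n) (i : 'I_n) (eps : R)
      (d0 : measure_display) (Om0 : measurableType d0)
      (PP : 'I_n -> probability Om0 R) (X : nat -> Om0 -> 'I_n) (tm : nat),
      stochastic P -> irreducible P -> stationary P pi ->
      markov_family PP P X ->
      is_tmix P pi tm -> (0 < tm)%N ->
      0 < eps < 1 -> eps < eps0 ->
      log2 (2 * H_max PP X i * log2 (8 * Zmax P pi i / eps)) <=
      C * ln (tm%:R / pi 0 i * ln (tm%:R / eps)))
  /\
  (* every member of the first soft-O class belongs to the second one *)
  (forall (C : R) (c : nat), 0 < C ->
    exists (C' eps0 alpha0 : R) (c' : nat),
    [/\ 0 < C', 0 < eps0 & 0 < alpha0] /\
    forall (n : nat) (P : 'M[R]_n) (pi : 'rV[R]_n) (i : 'I_n) (eps alpha : R)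
      (d0 : measure_display) (Om0 : measurableType d0)
      (PP : 'I_n -> probability Om0 R) (X : nat -> Om0 -> 'I_n) (tm : nat),
      stochastic P -> irreducible P -> stationary P pi ->
      markov_family PP P X ->
      is_tmix P pi tm -> (0 < tm)%N ->
      0 < eps < 1 -> eps < eps0 -> 0 < alpha < 1 -> alpha < alpha0 ->
      softO C c [:: H_max PP X i; ln (1 / alpha); 1 / eps ^+ 2;
                    ln (Zmax P pi i / eps)] <=
      softO C' c' [:: tm%:R; ln (1 / alpha); 1 / pi 0 i; 1 / eps ^+ 2]).
Proof.
split; [|split].
- exists (224 * 64 * 256), 9^-1, 3^-1, 1%N; split.
    by split; rewrite ?invr_gt0 !(mulr_gt0, ltr0n).
  move=> n P pi i eps alpha d0 Om0 PP X d Om Pr Y stP irP stpi mfX mcY indY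
    eps01 /andP[al0 al1] x accurate; case/andP: (eps01) => e0 e1.
  have he0 : 0 < eps / 2 by rewrite divr_gt0.
  have he2 : eps / 2 <= 2^-1 by rewrite ler_pdivrMr // mulVf // ltW.
  rewrite (H_maxE i stP irP stpi mfX).
  have [G [mG PG Gacc]] := run_accurate_event stP mcY indY he0 he2 al0 al1.
  exists G; split => // w /Gacc acc.
  have accT k : 2 * hit_max P pi i * log2 (8 * Zmax P pi i / eps) <= (theta k.+1)%:R ->
      accurate w k.+1.
    move=> th; rewrite /accurate -[eps in in_pm eps](@divfK _ 2) // [_ * 2]mulrC.
    apply: (run_accurate_in_pm stP irP stpi he0 he2 al0 al1 acc).
    exact: Zmax_surv_cutoff.
  have c1 := cutoff_ge1 i stP irP stpi eps01.
  split=> [[//|k] _|eps9 al3].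
    by rewrite log2_le_theta ?(lt_le_trans _ c1) //; exact: accT.
  (* The first threshold past the cutoff overshoots it by at most a factor 2, so stopping there
     costs a number of steps of the order of the cutoff. *)
  have [k /andP[ck k2]] := theta_cover c1.
  exists k.+1; split => //.
    case=> [//|l] kl; apply: accT; apply: le_trans ck _.
    by rewrite ler_nat /theta leq_pexp2l.
  apply: le_trans (steps_le stP he0 he2 al0 al1 _ acc) _.
  exact: steps_softO.
- exists 384, (expR (-3)); split; first by split; [rewrite ltr0n|exact: expR_gt0].
  move=> n P pi i eps d0 Om0 PP X tm stP irP stpi mfX mx tm0 eps01 eps3.
  by rewrite (H_maxE i stP irP stpi mfX); exact: cutoff_le_mix.
- move=> C c C0; exists (C * 2 ^+ (c + c).+2), 9^-1, 1, (c + c).+1; split.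
    by split; rewrite ?invr_gt0 // mulr_gt0 // exprn_gt0.
  move=> n P pi i eps alpha d0 Om0 PP X tm stP irP stpi mfX mx tm0 eps01 eps9 al01 _.
  by rewrite (H_maxE i stP irP stpi mfX); exact: soft_le_mix.
Qed.
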